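(* Let $1<p<\infty$ and let $\mathcal D$ be a non-empty class of Banach lattices. The following are equivalent: (1) for every Banach space $E$, $\mathrm{FBL}^{\mathcal C_p}[E]=\mathrm{FBL}^{\mathcal D}[E]$ as sets and the norms $\rho_{\mathcal C_p}$ and $\rho_{\mathcal D}$ coincide there; (2) $\mathcal D\subseteq\mathcal C_p$ and $\ell^p\in\overline{\mathcal D}$.
   Context: $\mathrm{FVL}[E]$ is the vector sublattice of $C(B_{E^*})$ generated by $\delta_x(x^* )=x^*(x)$; linear maps $T:E\to Y$ (Archimedean $Y$) extend uniquely to vector lattice homomorphisms $\widehat T$ on $\mathrm{FVL}[E]$. For a class $\mathcal C$ of Banach lattices, $\rho_{\mathcal C}(f)=\sup\{\|\widehat Tf\|_Y:Y\in\mathcal C,\ T:E\to Y\text{ linear contraction}\}$ and $\mathrm{FBL}^{\mathcal C}[E]$ is the completion of $(\mathrm{FVL}[E],\rho_{\mathcal C})$. $\overline{\mathcal C}$ is the class of Banach lattices lattice isometric to a closed sublattice of some $(\bigoplus_{\gamma\in\Gamma}X_\gamma)_\infty$ with all $X_\gamma\in\mathcal C$. $\mathcal C_p$ is the class of Banach lattices with $p$-convexity constant $1$. *)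

(* Defs.v *)
From HB Require Import structures.
From mathcomp Require Import all_boot all_order all_algebra.
From mathcomp Require Import all_classical all_reals all_analysis.
Set Implicit Arguments. Unset Strict Implicit. Unset Printing Implicit Defensive.
Import Order.TTheory GRing.Theory Num.Theory.
Import numFieldNormedType.Exports.
Local Open Scope classical_set_scope.
Local Open Scope ring_scope.

(* A Banach lattice is a (real) Banach space [bl_carrier] together with *)
(* a join operation making it a vector lattice (Riesz space), whose     *)
(* order is  x <= y  iff  x \/ y = y,  and whose norm is a lattice norm *)
(* ( |x| <= |y| -> ||x|| <= ||y||, where |x| = x \/ -x ).              *)
Record BanachLattice (R : realType) := BanachLatticeMk {
  bl_carrier :> completeNormedModType R;
  bl_join : bl_carrier -> bl_carrier -> bl_carrier;
  bl_joinC : forall x y, bl_join x y = bl_join y x;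
  bl_joinA : forall x y z, bl_join x (bl_join y z) = bl_join (bl_join x y) z;
  bl_joinxx : forall x, bl_join x x = x;
  bl_joinD : forall x y z, bl_join (x + z) (y + z) = bl_join x y + z;
  bl_joinZ : forall (a : R) x y, 0 <= a ->
               bl_join (a *: x) (a *: y) = a *: bl_join x y;
  bl_normM : forall x y,
               bl_join (bl_join x (- x)) (bl_join y (- y)) = bl_join y (- y) ->
               `|x| <= `|y|
}.

Section BL.
Context {R : realType}.

Definition bl_le (X : BanachLattice R) (x y : X) : Prop := bl_join x y = y.

Definition bl_is_lub (X : BanachLattice R) (S : set X) (z : X) : Prop :=
  (forall s, S s -> bl_le s z) /\
  (forall w, (forall s, S s -> bl_le s w) -> bl_le z w).

Definition conj_exp (p : R) : R := p / (p - 1).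

(* p-convexity constant 1:
   || (\sum_i |x_i|^p)^(1/p) || <= (\sum_i ||x_i||^p)^(1/p)
   for every finite family x_1..x_n, where the Krivine functional calculus
   element (\sum_i |x_i|^p)^(1/p) is the supremum in X of
   { \sum_i a_i x_i : \sum_i |a_i|^p' <= 1 }. *)
Definition p_convex1 (p : R) (X : BanachLattice R) : Prop :=
  forall (n : nat) (x : 'I_n -> X) (z : X),
    bl_is_lub [set \sum_(i < n) a i *: x i | a in
                 [set a : 'I_n -> R | \sum_(i < n) `|a i| `^ conj_exp p <= 1]] z ->
    `|z| <= (\sum_(i < n) `|x i| `^ p) `^ p^-1.

Definition Cp (p : R) : BanachLattice R -> Prop := p_convex1 p.

(* Free vector lattice FVL[E]: its elements are exactly the functions  *)
(* on B_{E*} obtained from the delta_x by finitely many vector lattice  *)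
(* operations, i.e. values of lattice terms over E.  For a linear map   *)
(* T : E -> Y, the unique vector lattice homomorphism T^ extending T    *)
(* sends the element represented by a term t to the evaluation of t in  *)
(* Y with variables x interpreted as T x.                               *)
Inductive lterm (E : Type) : Type :=
| LVar of E
| LAdd of lterm E & lterm E
| LScale of R & lterm E
| LJoin of lterm E & lterm E.

Fixpoint lterm_eval (E : Type) (X : BanachLattice R) (T : E -> X)
    (t : lterm E) : X :=
  match t with
  | LVar x => T x
  | LAdd s u => lterm_eval T s + lterm_eval T u
  | LScale a s => a *: lterm_eval T s
  | LJoin s u => bl_join (lterm_eval T s) (lterm_eval T u)
  end.

Definition lin_contraction (E : normedModType R) (Y : BanachLattice R)
    (T : E -> Y) : Prop :=
  (forall (a : R) (x y : E), T (a *: x + y) = a *: T x + T y) /\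
  (forall x, `|T x| <= `|x|).

Definition rho (C : BanachLattice R -> Prop) (E : normedModType R)
    (t : lterm E) : \bar R :=
  ereal_sup [set r : \bar R | exists (Y : BanachLattice R) (T : E -> Y),
     [/\ C Y, lin_contraction T & r = (`|lterm_eval T t|)%:E]].

Definition in_lp (p : R) (x : R ^nat) : Prop :=
  cvgn (series (fun k => `|x k| `^ p)).

Definition lp_norm (p : R) (x : R ^nat) : R :=
  (limn (series (fun k => `|x k| `^ p))) `^ p^-1.

(* l^p belongs to the closure Dbar of the class D: l^p is lattice
   isometric to a closed sublattice of some (\bigoplus_{g in G} X_g)_oo
   with all X_g in D.  Equivalently: there are an index type G, Banach
   lattices X_g in D and maps J_g : l^p -> X_g (the coordinates of the
   embedding) such that x |-> (J_g x)_g is linear, a lattice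
   homomorphism, and an isometry into the l^oo-sum:
   ||x||_p = sup_g ||J_g x|| (sup of the empty family being 0).  The
   range of an isometry from the complete space l^p is automatically
   closed. *)
Definition lp_in_closure (p : R) (D : BanachLattice R -> Prop) : Prop :=
  exists (G : Type) (X : G -> BanachLattice R)
         (J : forall g : G, R ^nat -> X g),
    [/\ forall g, D (X g),
        forall g (a : R) (x y : R ^nat), in_lp p x -> in_lp p y ->
          J g (fun k => a * x k + y k) = a *: J g x + J g y,
        forall g (x y : R ^nat), in_lp p x -> in_lp p y ->
          J g (fun k => Num.max (x k) (y k)) = bl_join (J g x) (J g y),
        forall g (x : R ^nat), in_lp p x -> `|J g x| <= lp_norm p x
      & forall (x : R ^nat) (r : R), in_lp p x -> 0 <= r ->
          (forall g, `|J g x| <= r) -> lp_norm p x <= r].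
End BL.

(* Main.v *)
Require Import Defs.
From HB Require Import structures.
From mathcomp Require Import all_boot all_order all_algebra.
From mathcomp Require Import all_classical all_reals all_analysis.
From mathcomp Require Import ring lra.
Import Order.TTheory GRing.Theory Num.Theory.
Import numFieldNormedType.Exports.
Local Open Scope classical_set_scope.
Local Open Scope ring_scope.

Set Implicit Arguments.
Unset Strict Implicit.
Unset Printing Implicit Defensive.

(* Both implications rest on the fact that an inequality between lattice terms
   holds in every Banach lattice as soon as it holds for all real-valued linear
   functionals: a term is a join of meets of vectors, a positive functional is
   below the minimum on a meet, and positive functionals determine the order.

   (2) => (1).  For a term t over E let Q be the infimum of sum |x_j|^p over the
   finite families with |f_t|^p <= sum |f x_j|^p for all linear f : E -> R.  By
   the transfer above, |T^ t| <= (sum |T x_j|^p)^(1/p) in every lattice of C_p,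
   so |T^ t|^p <= Q for every contraction T into such a lattice.  Hahn-Banach
   gives a positive functional phi on functions of f with phi(|f_t|^p) = Q and
   phi(|f x|^p) <= |x|^p.  Since t is piecewise linear, averaging phi over
   finitely many cells where t is linear yields a contraction S : E -> l^p_n with
   |S^ t|^p = Q, and l^p embeds in products of lattices of D.

   (1) => (2).  Applied to finite joins of vectors sum a_i x_i, equality of the
   norms transfers p-convexity from C_p to D.  For E = l^p_n the terms
   (|e_k| - sum_{j <> k} |e_j|)^+ are pairwise disjoint, and map to e_k under the
   identity of l^p_n; their images under contractions into members of D are the
   coordinates of an isometric lattice embedding of l^p. *)

(** * Powers with exponent p and the p-norm of a finite real family *)

Lemma powR_inv {R : realType} (x r : R) : 0 <= x -> x^-1 `^ r = (x `^ r)^-1.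
Proof. by move=> x0; rewrite -powR_inv1// -powRrM mulN1r powRN. Qed.

Section PNorm.
Context {R : realType} (p : R).
Hypothesis p1 : 1 < p.

Let p0 : 0 < p. Proof. exact: lt_trans p1. Qed.
Let pN0 : p != 0. Proof. by rewrite gt_eqF. Qed.
Let pB1_gt0 : 0 < p - 1. Proof. by rewrite subr_gt0. Qed.

Lemma conj_exp_gt0 : 0 < conj_exp p.
Proof. by rewrite divr_gt0. Qed.

Lemma conj_expP : p^-1 + (conj_exp p)^-1 = 1.
Proof.
by rewrite /conj_exp invf_div -{1}(div1r p) -mulrDl subrKC mulfV.
Qed.

Lemma powR_conj_exp (x : R) : (x `^ (p - 1)) `^ conj_exp p = x `^ p.
Proof. by rewrite -powRrM /conj_exp mulrCA divff ?mulr1// gt_eqF. Qed.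

Lemma ler_powRp (x y : R) : 0 <= x -> x <= y -> x `^ p <= y `^ p.
Proof.
move=> x0 xy; apply: ge0_ler_powR; rewrite ?nnegrE ?(ltW p0)//.
exact: le_trans xy.
Qed.

Lemma ler_powRVp (x y : R) : 0 <= x -> x <= y -> x `^ p^-1 <= y `^ p^-1.
Proof.
move=> x0 xy; apply: ge0_ler_powR; rewrite ?nnegrE ?invr_ge0 ?(ltW p0)//.
exact: le_trans xy.
Qed.

Lemma powRpK (x : R) : 0 <= x -> (x `^ p) `^ p^-1 = x.
Proof. by move=> x0; rewrite -powRrM mulfV// powRr1. Qed.

Lemma powRVpK (x : R) : 0 <= x -> (x `^ p^-1) `^ p = x.
Proof. by move=> x0; rewrite -powRrM mulVf// powRr1. Qed.

Lemma ler_powRpP (x y : R) : 0 <= x -> 0 <= y -> x `^ p <= y `^ p -> x <= y.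
Proof.
move=> x0 y0 /(ler_powRVp (powR_ge0 _ _)).
by rewrite !powRpK.
Qed.

(* Young's inequality for [g] and [m `^ (p - 1)]. *)
Lemma powR_tangent (g m : R) : 0 <= g -> 0 <= m ->
  m `^ p + p * m `^ (p - 1) * (g - m) <= g `^ p.
Proof.
move=> g0 m0.
have := conjugate_powR g0 (powR_ge0 m (p - 1)) p0 conj_exp_gt0 conj_expP.
rewrite powR_conj_exp -(ler_pM2l p0) mulrDr [p * (_ / p)]mulrCA divff// mulr1.
have -> : p * (m `^ p / conj_exp p) = (p - 1) * m `^ p.
  by rewrite /conj_exp invf_div; field.
have <- := mulr_powRB1 m0 p0.
set c := m `^ (p - 1); set d := g `^ p => h.
suff -> : m * c + p * c * (g - m) = p * (g * c) - (p - 1) * (m * c).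
  by rewrite lerBlDr.
ring.
Qed.

Section FiniteFamily.
Context {I : finType}.
Implicit Types x a : I -> R.

Definition pnorm x : R := (\sum_i `|x i| `^ p) `^ p^-1.

Lemma sum_powR_ge0 (r : R) x : 0 <= \sum_i `|x i| `^ r.
Proof. by apply: sumr_ge0 => i _; exact: powR_ge0. Qed.

Lemma pnorm_ge0 x : 0 <= pnorm x.
Proof. exact: powR_ge0. Qed.

Lemma powR_pnorm x : pnorm x `^ p = \sum_i `|x i| `^ p.
Proof. by rewrite powRVpK// sum_powR_ge0. Qed.

Lemma ler_pnorm x y : (forall i, `|x i| <= `|y i|) -> pnorm x <= pnorm y.
Proof.
move=> xy; apply: ler_powRVp; first exact: sum_powR_ge0.
by apply: ler_sum => i _; exact: ler_powRp.
Qed.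

Lemma pnorm_coord x i : `|x i| <= pnorm x.
Proof.
rewrite -[leLHS]powRpK// ler_powRVp ?powR_ge0//.
by rewrite (bigD1 i)//= lerDl; apply: sumr_ge0 => j _; exact: powR_ge0.
Qed.

Lemma pnorm_eq0 x : pnorm x = 0 -> forall i, x i = 0.
Proof.
by move=> x0 i; apply/eqP; rewrite -normr_le0 -x0 pnorm_coord.
Qed.

Lemma pnormZ (c : R) x : pnorm (fun i => c * x i) = `|c| * pnorm x.
Proof.
rewrite /pnorm (eq_bigr (fun i => `|c| `^ p * `|x i| `^ p)); last first.
  by move=> i _; rewrite normrM powRM.
by rewrite -mulr_sumr powRM ?powR_ge0 ?sum_powR_ge0// powRpK.
Qed.

(** Hölder's inequality against the unit ball of the conjugate exponent: Young's inequality is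
    applied to each [|x i| / pnorm x] and [|a i|], then summed. *)
Lemma ler_sum_pnorm a x :
  \sum_i `|a i| `^ conj_exp p <= 1 -> \sum_i a i * x i <= pnorm x.
Proof.
move=> a1; have := pnorm_ge0 x; rewrite le_eqVlt => /predU1P[N0|N0].
  rewrite -N0 big1// => i _.
  by rewrite (pnorm_eq0 (esym N0)) mulr0.
rewrite -[leRHS]mul1r -ler_pdivrMr// mulr_suml.
have le1 i : a i * x i / pnorm x <=
    `|x i| `^ p / pnorm x `^ p / p + `|a i| `^ conj_exp p / conj_exp p.
  have xN : 0 <= `|x i| / pnorm x by rewrite divr_ge0// ltW.
  have := conjugate_powR xN (normr_ge0 (a i)) p0 conj_exp_gt0 conj_expP.
  have iN0 : 0 <= (pnorm x)^-1 by rewrite invr_ge0 ltW.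
  rewrite powRM// (powR_inv _ (ltW N0)).
  apply: le_trans; rewrite [leRHS]mulrAC ler_pM2r ?invr_gt0//.
  by rewrite mulrC -normrM ler_norm.
apply: (le_trans (ler_sum _ (fun i _ => le1 i))).
rewrite big_split/= -!mulr_suml -powR_pnorm divff; last first.
  by rewrite powR_eq0 negb_and gt_eqF.
rewrite div1r -[leRHS]conj_expP lerD2l -[leRHS]mul1r ler_pM2r//.
by rewrite invr_gt0 conj_exp_gt0.
Qed.

(** The equality case of Hölder: for non-zero [x] the extremal vector is [sg (x i) |x i|^(p-1)],
    normalised by [pnorm x ^ (p-1)]. *)
Lemma pnorm_attained x : exists2 a : I -> R,
  \sum_i `|a i| `^ conj_exp p <= 1 & \sum_i a i * x i = pnorm x.
Proof.
have qN0 : conj_exp p != 0 by rewrite gt_eqF// conj_exp_gt0.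
have := pnorm_ge0 x; rewrite le_eqVlt => /predU1P[N0|N0].
  exists (fun=> 0); first by rewrite big1// => i _; rewrite normr0 powR0.
  by rewrite big1// => i _; rewrite mul0r.
have N0' : pnorm x != 0 by rewrite gt_eqF.
exists (fun i => Num.sg (x i) * `|x i| `^ (p - 1) / pnorm x `^ (p - 1)).
  rewrite (eq_bigr (fun i => `|x i| `^ p / pnorm x `^ p)).
    by rewrite -mulr_suml -powR_pnorm divff// powR_eq0 negb_and N0'.
  move=> i _; rewrite !normrM normr_sg.
  have [->|xi0] := eqVneq (x i) 0.
    by rewrite normr0 mul0r mul0r powR0// powR0// mul0r.
  have iN0 : 0 <= (pnorm x `^ (p - 1))^-1 by rewrite invr_ge0 powR_ge0.
  rewrite mul1r (ger0_norm (powR_ge0 _ _)) (ger0_norm iN0).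
  rewrite powRM ?powR_ge0// powR_conj_exp.
  by rewrite (powR_inv _ (powR_ge0 (pnorm x) (p - 1))) powR_conj_exp.
rewrite (eq_bigr (fun i => `|x i| `^ p / pnorm x `^ (p - 1))); last first.
  move=> i _; rewrite mulrAC; congr (_ / _).
  by rewrite mulrAC -normrEsg mulr_powRB1.
rewrite -mulr_suml -powR_pnorm -(mulr_powRB1 (pnorm_ge0 x) p0) mulfK//.
by rewrite powR_eq0 negb_and N0'.
Qed.

(** Minkowski's inequality by duality: the p-norm is a maximum of linear functionals. *)
Lemma pnormD x y : pnorm (fun i => x i + y i) <= pnorm x + pnorm y.
Proof.
have [a a1 <-] := pnorm_attained (fun i => x i + y i).
rewrite (eq_bigr (fun i => a i * x i + a i * y i)); last first.
  by move=> i _; rewrite mulrDr.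
by rewrite big_split/= lerD// ler_sum_pnorm.
Qed.

End FiniteFamily.
End PNorm.

(** * Hahn-Banach *)

Section HahnBanach.
Context {R : realType} {V : lmodType R} (W : set V).
Hypothesis WP : forall a u v, W u -> W v -> W (a *: u + v).

(** The domain is a set [W] closed under linear combinations, not a subspace type, because the gauge
    used later is meaningful only on dominated functions. *)
Definition sublinear_on (q : V -> R) : Prop :=
  (forall u v, W u -> W v -> q (u + v) <= q u + q v) /\
  (forall a u, 0 < a -> W u -> q (a *: u) = a * q u).

Let WD u v : W u -> W v -> W (u + v).
Proof. by move=> Wu Wv; rewrite -[u]scale1r; exact: WP. Qed.

Let W0 u : W u -> W 0.
Proof. by move=> Wu; rewrite -(subrr u) addrC -scaleN1r; exact: WP. Qed.

Let WZ a u : W u -> W (a *: u).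
Proof. by move=> Wu; rewrite -[_ *: _]addr0; apply: WP => //; exact: W0 Wu. Qed.

Let WN u : W u -> W (- u).
Proof. by move=> Wu; rewrite -scaleN1r; exact: WZ. Qed.

Lemma sublinear_on0 q u : sublinear_on q -> W u -> q 0 = 0.
Proof.
move=> [_ qZ] /W0 w0; have := qZ 2 0 (ltr0n _ 2) w0.
by rewrite scaler0; lra.
Qed.

Lemma sublinear_onN q u : sublinear_on q -> W u -> - q (- u) <= q u.
Proof.
move=> sq Wu; have := sq.1 u (- u) Wu (WN Wu).
by rewrite subrr (sublinear_on0 sq Wu); lra.
Qed.

(** One criterion serves three infima: the lowering of a functional along a vector, the lower bound
    of a chain in Zorn's lemma, and the gauge in [lp_norming]. The bound [b] keeps each infimum
    finite. *)
Lemma inf_sublinear_on (J : Type) (P : V -> set J) (h : J -> V -> R) (b : V -> R) :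
  (forall u, W u -> P u !=set0) ->
  (forall j u, P u j -> W u -> b u <= h j u) ->
  (forall i j u v, P u i -> P v j -> W u -> W v ->
     exists2 k, P (u + v) k & h k (u + v) <= h i u + h j v) ->
  (forall a j u, 0 < a -> P u j -> W u ->
     exists2 k, P (a *: u) k & h k (a *: u) <= a * h j u) ->
  sublinear_on (fun u => inf [set h j u | j in P u]).
Proof.
move=> P0 hb hD hZ; pose g u := inf [set h j u | j in P u].
have lb u : W u -> has_lbound [set h j u | j in P u].
  by move=> Wu; exists (b u) => _ [j Pj <-]; exact: hb.
have gle u j : W u -> P u j -> g u <= h j u.
  by move=> Wu Pj; apply: ge_inf; [exact: lb | exists j].
have leg u c : W u -> (forall j, P u j -> c <= h j u) -> c <= g u.
  move=> /P0[j0 Pj0] hc; apply: lb_le_inf; first by exists (h j0 u), j0.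
  by move=> _ [j Pj <-]; exact: hc.
have gZ a u : 0 < a -> W u -> g (a *: u) <= a * g u.
  move=> a0 Wu; rewrite -ler_pdivrMl//; apply: (leg _ _) => // j Pj.
  rewrite ler_pdivrMl//; have [k Pk] := hZ a j u a0 Pj Wu.
  by apply: le_trans; exact: gle (WZ a Wu) Pk.
split=> [u v Wu Wv|a u a0 Wu].
  rewrite -lerBlDr; apply: (leg _ _) => // i Pi.
  rewrite lerBlDr [leRHS]addrC -lerBlDr; apply: (leg _ _) => // j Pj.
  rewrite lerBlDr [leRHS]addrC.
  have [k Pk] := hD i j u v Pi Pj Wu Wv.
  by apply: le_trans; exact: gle (WD Wu Wv) Pk.
apply/eqP; rewrite eq_le gZ//= -ler_pdivlMl//.
have := gZ a^-1 (a *: u) _ (WZ a Wu); rewrite invr_gt0 => /(_ a0).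
by rewrite scalerA mulVf ?gt_eqF// scale1r.
Qed.

(** The witness is [q' v = inf (q (v + r u) - r q u)] over [r >= 0]; the values [r = 0] and [r = 1]
    give the two bounds. *)
Lemma sublinear_on_decr q u : sublinear_on q -> W u ->
  exists q', [/\ sublinear_on q', forall v, W v -> q' v <= q v &
                 forall v, W v -> q' v <= q (v + u) - q u].
Proof.
move=> sq Wu; pose P := [set r : R | 0 <= r].
pose h (r : R) v := q (v + r *: u) - r * q u.
have hr r : 0 <= r -> q (r *: u) = r * q u.
  rewrite le_eqVlt => /predU1P[<-|r0]; last exact: sq.2.
  by rewrite scale0r mul0r (sublinear_on0 sq Wu).
have lb r v : 0 <= r -> W v -> - q (- v) <= h r v.
  move=> r0 Wv; rewrite /h -hr//.
  have := sq.1 (v + r *: u) (- v) (WD Wv (WZ r Wu)) (WN Wv).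
  by rewrite addrAC subrr add0r; lra.
have P0 : P 0 by rewrite /P /=.
exists (fun v => inf [set h r v | r in P]).
have gle r v : 0 <= r -> W v -> inf [set h r v | r in P] <= h r v.
  move=> r0 Wv; apply: ge_inf; last by exists r.
  by exists (- q (- v)) => _ [s s0 <-]; exact: lb.
split.
- apply: (@inf_sublinear_on _ (fun=> P) h (fun v => - q (- v))).
  + by exists 0.
  + by move=> r v; exact: lb.
  + move=> r s v w r0 s0 Wv Ww; exists (r + s); first exact: addr_ge0.
    rewrite /h scalerDl addrACA mulrDl.
    have := sq.1 _ _ (WD Wv (WZ r Wu)) (WD Ww (WZ s Wu)); lra.
  + move=> a r v a0 r0 Wv; exists (a * r).
      by rewrite /P /= mulr_ge0// ltW.
    rewrite /h -scalerA -scalerDr sq.2//; last exact: WD (WZ r Wu).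
    by rewrite mulrBr mulrA.
- move=> v Wv; apply: (le_trans (gle 0 v _ Wv)) => //.
  by rewrite /h scale0r addr0 mul0r subr0.
- move=> v Wv; apply: (le_trans (gle 1 v _ Wv)) => //.
  by rewrite /h scale1r mul1r.
Qed.

(* A sublinear functional that is minimal on [W] is linear there. *)
Theorem hahn_banach (q : V -> R) (v0 : V) : sublinear_on q -> W v0 ->
  exists phi : V -> R,
    [/\ forall a u v, W u -> W v -> phi (a *: u + v) = a * phi u + phi v,
        forall u, W u -> phi u <= q u & phi v0 = q v0].
Proof.
(* Lowering [q] along [v0] first gives [q0 (- v0) <= - q v0], so a linear functional below [q0] must
   take the value [q v0] at [v0]. *)
move=> sq Wv0; have [q0 [sq0 q0q q0v]] := sublinear_on_decr sq Wv0.
pose ok m := sublinear_on m /\ forall u, W u -> m u <= q0 u.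
pose T := {m : V -> R | ok m}.
(* The order is reversed: a maximal element for [Rm] is a pointwise minimal functional on [W]. *)
pose Rm (m n : T) := `[< forall u, W u -> sval n u <= sval m u >].
have t0 : T by exists q0.
have [|m1 m2 m3 /asboolP h1 /asboolP h2|A totA|[m [sm mq]] mmin] :=
    @ZL_preorder T t0 Rm.
- by move=> m; apply/asboolP.
- by apply/asboolP => u Wu; apply: le_trans (h2 u Wu) (h1 u Wu).
- have [[m0 Am0]|A0] := pselect (A !=set0); last first.
    by exists t0 => s As; exfalso; apply: A0; exists s.
  have lb (m : T) u : A m -> W u -> - q0 (- u) <= sval m u.
    move=> Am Wu; apply: le_trans (sublinear_onN (svalP m).1 Wu).
    by rewrite lerN2; apply: (svalP m).2; exact: WN.
  have sg : sublinear_on (fun u => inf [set sval j u | j in A]).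
    apply: (@inf_sublinear_on _ (fun=> A) (fun m => sval m) (fun u => - q0 (- u))).
    + by exists m0.
    + by move=> j u; exact: lb.
    + move=> i j u v Ai Aj Wu Wv; have [/asboolP h|/asboolP h] := totA i j Ai Aj.
        exists j => //; apply: le_trans ((svalP j).1.1 u v Wu Wv) _.
        by rewrite lerD2r h.
      exists i => //; apply: le_trans ((svalP i).1.1 u v Wu Wv) _.
      by rewrite lerD2l h.
    + by move=> a j u a0 Aj Wu; exists j => //; rewrite (svalP j).1.2.
  have gle u j : A j -> W u -> inf [set sval j u | j in A] <= sval j u.
    move=> Aj Wu; apply: ge_inf; last by exists j.
    by exists (- q0 (- u)) => _ [s As <-]; exact: lb.
  have gT : ok (fun u => inf [set sval j u | j in A]).
    split=> // u Wu; apply: le_trans (gle u m0 Am0 Wu) _.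
    exact: (svalP m0).2.
  by exists (@exist _ ok _ gT) => s As; apply/asboolP => u Wu; exact: gle.
have mD u v : W u -> W v -> m (u + v) = m u + m v.
  move=> Wu Wv; apply/eqP; rewrite eq_le sm.1//=.
  (* By minimality, lowering [m] along [u] changes nothing, so [m v <= m (v + u) - m u], the missing
     half of additivity. *)
  have [m' [sm' m'm m'u]] := sublinear_on_decr sm Wu.
  have m'T : ok m'.
    by split=> // w Ww; apply: le_trans (m'm w Ww) (mq w Ww).
  have /asboolP/(_ v Wv)/= := mmin (@exist _ ok m' m'T)
    (introT (asboolP _) (fun w Ww => m'm w Ww)).
  by have := m'u v Wv; rewrite [v + u]addrC; lra.
have mN u : W u -> m (- u) = - m u.
  move=> Wu; have := mD u (- u) Wu (WN Wu).
  by rewrite subrr (sublinear_on0 sm Wu); lra.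
have mZ a u : W u -> m (a *: u) = a * m u.
  move=> Wu; have [a0|a0|->] := ltgtP a 0.
  - rewrite -[a]opprK scaleNr mN; last exact: WZ.
    by rewrite sm.2 ?oppr_gt0// -mulNr.
  - exact: sm.2.
  - by rewrite scale0r mul0r (sublinear_on0 sm Wu).
exists m; split.
- by move=> a u v Wu Wv; rewrite mD ?mZ//; exact: WZ.
- by move=> u Wu; apply: le_trans (mq u Wu) (q0q u Wu).
- apply/eqP; rewrite eq_le (le_trans (mq v0 Wv0) (q0q v0 Wv0))/=.
  have := le_trans (mq _ (WN Wv0)) (q0v _ (WN Wv0)).
  by rewrite mN// addNr (sublinear_on0 sq Wv0); lra.
Qed.

End HahnBanach.

(** * Vector lattices *)

Section VectorLattice.
Context {R : realType} {X : BanachLattice R}.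
Implicit Types x y z u v w : X.

Definition bl_meet x y : X := - bl_join (- x) (- y).
Definition bl_abs x : X := bl_join x (- x).

Lemma bl_lexx x : bl_le x x.
Proof. exact: bl_joinxx. Qed.

Lemma bl_le_trans y x z : bl_le x y -> bl_le y z -> bl_le x z.
Proof. by rewrite /bl_le => xy <-; rewrite bl_joinA xy. Qed.

Lemma bl_le_anti x y : bl_le x y -> bl_le y x -> x = y.
Proof. by rewrite /bl_le bl_joinC => -> . Qed.

Lemma bl_leUl x y : bl_le x (bl_join x y).
Proof. by rewrite /bl_le bl_joinA bl_joinxx. Qed.

Lemma bl_leUr x y : bl_le y (bl_join x y).
Proof. by rewrite bl_joinC; exact: bl_leUl. Qed.

Lemma bl_leUx x y z : bl_le x z -> bl_le y z -> bl_le (bl_join x y) z.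
Proof. by rewrite /bl_le => xz yz; rewrite -bl_joinA yz xz. Qed.

Lemma bl_leD2r z x y : bl_le x y -> bl_le (x + z) (y + z).
Proof. by rewrite /bl_le bl_joinD => ->. Qed.

Lemma bl_leD x y u v : bl_le x y -> bl_le u v -> bl_le (x + u) (y + v).
Proof.
move=> xy uv; apply: (@bl_le_trans (y + u)); first exact: bl_leD2r.
by rewrite ![y + _]addrC; exact: bl_leD2r.
Qed.

Lemma bl_subr_ge0 x y : bl_le 0 (y - x) <-> bl_le x y.
Proof.
split=> [/(bl_leD2r x)|/(bl_leD2r (- x))]; first by rewrite add0r subrK.
by rewrite subrr.
Qed.

Lemma bl_subr_le0 x y : bl_le (x - y) 0 <-> bl_le x y.
Proof.
split=> [/(bl_leD2r y)|/(bl_leD2r (- y))]; first by rewrite add0r subrK.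
by rewrite subrr.
Qed.

Lemma bl_leN x y : bl_le x y -> bl_le (- y) (- x).
Proof. by move/bl_subr_ge0 => xy; apply/bl_subr_ge0; rewrite opprK addrC. Qed.

Lemma bl_oppr_le0 x : bl_le 0 x -> bl_le (- x) 0.
Proof. by move/bl_leN; rewrite oppr0. Qed.

Lemma bl_leZ (a : R) x y : 0 <= a -> bl_le x y -> bl_le (a *: x) (a *: y).
Proof. by rewrite /bl_le => a0 xy; rewrite bl_joinZ// xy. Qed.

Lemma bl_scale_ge0 (a : R) x : 0 <= a -> bl_le 0 x -> bl_le 0 (a *: x).
Proof. by move=> a0 /(bl_leZ a0); rewrite scaler0. Qed.

Lemma bl_scale2r (a b : R) x : bl_le 0 x -> a <= b -> bl_le (a *: x) (b *: x).
Proof.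
move=> x0 ab; apply/bl_subr_ge0; rewrite -scalerBl.
by apply: bl_scale_ge0 => //; rewrite subr_ge0.
Qed.

Lemma bl_sum_le (I : finType) (f g : I -> X) :
  (forall i, bl_le (f i) (g i)) -> bl_le (\sum_i f i) (\sum_i g i).
Proof.
move=> fg; elim/big_ind2 : _ => //; first exact: bl_lexx.
by move=> x1 x2 y1 y2; exact: bl_leD.
Qed.

Lemma bl_le_abs x : bl_le x (bl_abs x).
Proof. exact: bl_leUl. Qed.

Lemma bl_leN_abs x : bl_le (- x) (bl_abs x).
Proof. exact: bl_leUr. Qed.

Lemma bl_abs_ge0 x : bl_le 0 (bl_abs x).
Proof.
have := bl_leD (bl_le_abs x) (bl_leN_abs x); rewrite subrr.
move=> /(@bl_leZ 2^-1); rewrite scaler0 -{1 2}[bl_abs x]scale1r -scalerDl.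
by rewrite scalerA mulVf// scale1r; apply; rewrite invr_ge0.
Qed.

Lemma bl_sum_abs_ge0 (I : finType) (f : I -> X) : bl_le 0 (\sum_i bl_abs (f i)).
Proof.
elim/big_ind: _ => [|u v u0 v0|i _]; [exact: bl_lexx| |exact: bl_abs_ge0].
by rewrite -[0]addr0; exact: bl_leD.
Qed.

Lemma bl_abs_le x z : bl_le x z -> bl_le (- x) z -> bl_le (bl_abs x) z.
Proof. exact: bl_leUx. Qed.

Lemma bl_norm_le x z : bl_le x z -> bl_le (- x) z -> `|x| <= `|z|.
Proof.
move=> xz Nxz; apply: bl_normM.
by apply: bl_le_trans (bl_le_abs z); exact: bl_abs_le.
Qed.

Lemma bl_norm_abs x : `|bl_abs x| = `|x|.
Proof.
apply/eqP; rewrite eq_le; apply/andP; split; apply: bl_normM; last first.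
  exact: bl_le_abs.
apply: bl_abs_le; first exact: bl_lexx.
apply: (@bl_le_trans 0); last exact: bl_abs_ge0.
by apply: bl_oppr_le0; exact: bl_abs_ge0.
Qed.

Lemma bl_norm_pos x : `|bl_join x 0| <= `|x|.
Proof.
rewrite -(bl_norm_abs x); apply: bl_norm_le.
  by apply: bl_leUx; [exact: bl_le_abs | exact: bl_abs_ge0].
apply: (@bl_le_trans 0); last exact: bl_abs_ge0.
by apply: bl_oppr_le0; exact: bl_leUr.
Qed.

(** The order is closed in norm: [(x - z)^+] lies below [u^+], so its norm is at most every positive
    [e]. *)
Lemma bl_le_closed x z :
  (forall e : R, 0 < e -> exists2 u, `|u| <= e & bl_le x (z + u)) -> bl_le x z.
Proof.
move=> H; apply/bl_subr_le0.
suff : bl_join (x - z) 0 = 0 by [].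
apply/normr0_eq0/eqP; rewrite eq_le normr_ge0 andbT; apply/ler_addgt0Pr => e e0.
rewrite add0r; have [u ue xu] := H e e0.
apply: (le_trans _ ue); apply: (le_trans _ (bl_norm_pos u)).
apply: bl_norm_le.
  apply: bl_leUx; last exact: bl_leUr.
  apply: bl_le_trans (bl_leUl _ _).
  by have := bl_leD2r (- z) xu; rewrite addrAC subrr add0r.
apply: (@bl_le_trans 0); last exact: bl_leUr.
by apply: bl_oppr_le0; exact: bl_leUr.
Qed.

Lemma bl_meetE x y : bl_meet x y = x + y - bl_join x y.
Proof.
have JE : bl_join (- x) (- y) = bl_join y x + (- x - y).
  by rewrite -bl_joinD [y + _]addrC subrK addrA subrr add0r.
by rewrite /bl_meet JE -opprD opprB bl_joinC.
Qed.

Lemma bl_meetA x y z : bl_meet x (bl_meet y z) = bl_meet (bl_meet x y) z.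
Proof. by rewrite /bl_meet !opprK bl_joinA. Qed.

Lemma bl_leIl x y : bl_le (bl_meet x y) x.
Proof. by rewrite -{2}[x]opprK; apply: bl_leN; exact: bl_leUl. Qed.

Lemma bl_leIr x y : bl_le (bl_meet x y) y.
Proof. by rewrite -{2}[y]opprK; apply: bl_leN; exact: bl_leUr. Qed.

Lemma bl_lexI x y z : bl_le z x -> bl_le z y -> bl_le z (bl_meet x y).
Proof.
by move=> zx zy; rewrite -[z]opprK; apply: bl_leN; apply: bl_leUx; exact: bl_leN.
Qed.

Lemma bl_meetC x y : bl_meet x y = bl_meet y x.
Proof. by rewrite /bl_meet bl_joinC. Qed.

(** Meet and join of [x] and [v] add up to [x + v], so a bound [w] on the meet bounds [v] by
    [w + j - x]. Doing this for [v = y] and [v = z] bounds their join. *)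
Lemma bl_meetUr x y z :
  bl_meet x (bl_join y z) = bl_join (bl_meet x y) (bl_meet x z).
Proof.
set w := bl_join (bl_meet x y) _; apply: bl_le_anti; last first.
  apply: bl_leUx; apply: bl_lexI; try exact: bl_leIl;
    apply: bl_le_trans (bl_leIr _ _) _; [exact: bl_leUl|exact: bl_leUr].
rewrite bl_meetE; set j := bl_join x _.
have H v : bl_le v (bl_join y z) -> bl_le (bl_meet x v) w -> bl_le v (w + j - x).
  move=> vyz xvw; have -> : v = bl_meet x v + bl_join x v - x.
    by rewrite bl_meetE subrK addrAC subrr add0r.
  apply: bl_leD2r; apply: bl_leD xvw _.
  apply: bl_leUx; first exact: bl_leUl.
  by apply: bl_le_trans vyz _; exact: bl_leUr.
have := bl_leUx (H y (bl_leUl _ _) (bl_leUl _ _)) (H z (bl_leUr _ _) (bl_leUr _ _)).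
move/(bl_leD2r (x - j)).
by rewrite addrA addrA subrK addrK [_ + x]addrC.
Qed.

Lemma bl_meetUl x y z :
  bl_meet (bl_join x y) z = bl_join (bl_meet x z) (bl_meet y z).
Proof. by rewrite bl_meetC bl_meetUr ![bl_meet z _]bl_meetC. Qed.

Lemma bl_joinDr x y z : x + bl_join y z = bl_join (x + y) (x + z).
Proof. by rewrite ![x + _]addrC bl_joinD. Qed.

Lemma bl_meetDl x y z : bl_meet x y + z = bl_meet (x + z) (y + z).
Proof. by rewrite /bl_meet !opprD bl_joinD opprD opprK. Qed.

Lemma bl_meetDr x y z : x + bl_meet y z = bl_meet (x + y) (x + z).
Proof. by rewrite ![x + _]addrC bl_meetDl. Qed.

Lemma bl_meetZ (a : R) x y : 0 <= a ->
  bl_meet (a *: x) (a *: y) = a *: bl_meet x y.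
Proof. by move=> a0; rewrite /bl_meet scalerN -bl_joinZ// !scalerN. Qed.

End VectorLattice.

Section LinMap.
Context {R : realType}.

Definition lin_map (V W : lmodType R) (f : V -> W) : Prop :=
  forall (a : R) x y, f (a *: x + y) = a *: f x + f y.

Context {V W : lmodType R} (f : V -> W).
Hypothesis lf : lin_map f.

Lemma lin_map0 : f 0 = 0.
Proof.
have := lf 1 0 0; rewrite !scale1r add0r => /esym/eqP.
by rewrite -subr_eq0 addrK => /eqP.
Qed.

Lemma lin_mapD x y : f (x + y) = f x + f y.
Proof. by rewrite -{1}[x]scale1r lf scale1r. Qed.

Lemma lin_mapZ a x : f (a *: x) = a *: f x.
Proof. by rewrite -[a *: x]addr0 lf lin_map0 addr0. Qed.

Lemma lin_mapN x : f (- x) = - f x.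
Proof. by rewrite -scaleN1r lin_mapZ scaleN1r. Qed.

Lemma lin_mapB x y : f (x - y) = f x - f y.
Proof. by rewrite lin_mapD lin_mapN. Qed.

Lemma lin_map_sum (I : finType) (F : I -> V) : f (\sum_i F i) = \sum_i f (F i).
Proof. exact: (big_morph f lin_mapD lin_map0). Qed.

End LinMap.

(** * Normal form of lattice terms *)

(** Lists are non-empty because a vector lattice has neither a least nor a greatest element to serve
    as an empty join or meet. *)
Inductive ne (A : Type) := One of A | More of A & ne A.

Section NonEmptyList.
Context {A B : Type}.

Fixpoint ne_map (f : A -> B) (l : ne A) : ne B :=
  match l with One a => One (f a) | More a l => More (f a) (ne_map f l) end.

Fixpoint ne_cat (l k : ne A) : ne A :=
  match l with One a => More a k | More a l => More a (ne_cat l k) end.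

Fixpoint ne_fold (op : A -> A -> A) (l : ne A) : A :=
  match l with One a => a | More a l => op a (ne_fold op l) end.

Fixpoint ne_in (a : A) (l : ne A) : Prop :=
  match l with One b => b = a | More b l => b = a \/ ne_in a l end.

End NonEmptyList.

Fixpoint ne_pairs {A B C : Type} (g : A -> B -> C) (l : ne A) (k : ne B) : ne C :=
  match l with
  | One a => ne_map (g a) k
  | More a l => ne_cat (ne_map (g a) k) (ne_pairs g l k)
  end.

Lemma ne_map_cat {A B : Type} (f : A -> B) l k :
  ne_map f (ne_cat l k) = ne_cat (ne_map f l) (ne_map f k).
Proof. by elim: l => //= a l ->. Qed.

Lemma ne_map_comp {A B C : Type} (f : B -> C) (g : A -> B) l :
  ne_map f (ne_map g l) = ne_map (f \o g) l.
Proof. by elim: l => //= a l ->. Qed.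

Lemma eq_ne_map {A B : Type} (f g : A -> B) l : f =1 g -> ne_map f l = ne_map g l.
Proof. by move=> fg; elim: l => [a|a l IH] /=; rewrite fg ?IH. Qed.

Lemma ne_fold_cat {A : Type} (op : A -> A -> A) l k : associative op ->
  ne_fold op (ne_cat l k) = op (ne_fold op l) (ne_fold op k).
Proof. by move=> opA; elim: l => //= a l ->; rewrite opA. Qed.

Lemma ne_fold_morph {A B : Type} (f : A -> B) opA opB l :
  {morph f : x y / opA x y >-> opB x y} ->
  ne_fold opB (ne_map f l) = f (ne_fold opA l).
Proof. by move=> fM; elim: l => //= a l ->; rewrite fM. Qed.

(** Used for addition over joins, addition over meets, and meets over joins; [h], [h1], [h2]
    interpret the entries, which lets the first two be nested. *)
Lemma ne_fold_pairs {A B C D : Type} (op ot : D -> D -> D) (g : A -> B -> C)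
    (h : C -> D) (h1 : A -> D) (h2 : B -> D) l k :
  associative op -> left_distributive ot op -> right_distributive ot op ->
  (forall a b, h (g a b) = ot (h1 a) (h2 b)) ->
  ne_fold op (ne_map h (ne_pairs g l k)) =
  ot (ne_fold op (ne_map h1 l)) (ne_fold op (ne_map h2 k)).
Proof.
move=> opA otl otr hg.
have row a : ne_fold op (ne_map h (ne_map (g a) k)) =
    ot (h1 a) (ne_fold op (ne_map h2 k)).
  by elim: k => [b|b k IH] /=; rewrite hg// IH otr.
by elim: l => [a|a l IH] //=; rewrite ne_map_cat ne_fold_cat// row IH otl.
Qed.

Section NormalForm.
Context {R : realType} {E : lmodType R}.

(* Both [t] and [- t] are written as joins of meets; carrying the two forms
   together avoids dualising when a scalar is negative. *)
Fixpoint lterm_nf (t : lterm (R := R) E) : ne (ne E) * ne (ne E) :=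
  match t with
  | LVar x => (One (One x), One (One (- x)))
  | LAdd s u =>
      let: (sp, sn) := lterm_nf s in let: (up, un) := lterm_nf u in
      (ne_pairs (ne_pairs +%R) sp up, ne_pairs (ne_pairs +%R) sn un)
  | LScale a s =>
      let: (sp, sn) := lterm_nf s in
      if 0 <= a then (ne_map (ne_map ( *:%R a)) sp, ne_map (ne_map ( *:%R a)) sn)
      else (ne_map (ne_map ( *:%R (- a))) sn, ne_map (ne_map ( *:%R (- a))) sp)
  | LJoin s u =>
      let: (sp, sn) := lterm_nf s in let: (up, un) := lterm_nf u in
      (ne_cat sp up, ne_pairs ne_cat sn un)
  end.

Definition nf_meet (X : BanachLattice R) (T : E -> X) (m : ne E) : X :=
  ne_fold bl_meet (ne_map T m).

Definition nf_eval (X : BanachLattice R) (T : E -> X) (P : ne (ne E)) : X :=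
  ne_fold (@bl_join R X) (ne_map (nf_meet T) P).

Context {X : BanachLattice R} (T : E -> X).
Hypothesis lT : lin_map T.

Let nf_evalZ a P : 0 <= a ->
  nf_eval T (ne_map (ne_map ( *:%R a)) P) = a *: nf_eval T P.
Proof.
move=> a0; have mZ m : nf_meet T (ne_map ( *:%R a) m) = a *: nf_meet T m.
  rewrite /nf_meet -(@ne_fold_morph _ _ ( *:%R a) bl_meet bl_meet); last first.
    by move=> x y; rewrite bl_meetZ.
  by rewrite !ne_map_comp; congr ne_fold; apply: eq_ne_map => x /=; exact: lin_mapZ.
rewrite /nf_eval -(@ne_fold_morph _ _ ( *:%R a) (@bl_join R X) (@bl_join R X)); last first.
  by move=> x y; rewrite bl_joinZ.
by rewrite !ne_map_comp; congr ne_fold; apply: eq_ne_map => m /=.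
Qed.

Let nf_evalD P Q :
  nf_eval T (ne_pairs (ne_pairs +%R) P Q) = nf_eval T P + nf_eval T Q.
Proof.
apply: ne_fold_pairs; first exact: bl_joinA.
- by move=> x y z; rewrite bl_joinD.
- by move=> x y z; rewrite bl_joinDr.
- move=> l k; apply: ne_fold_pairs; first exact: bl_meetA.
  + by move=> x y z; rewrite bl_meetDl.
  + by move=> x y z; rewrite bl_meetDr.
  + exact: lin_mapD.
Qed.

Let nf_eval_meet P Q :
  nf_eval T (ne_pairs ne_cat P Q) = bl_meet (nf_eval T P) (nf_eval T Q).
Proof.
apply: ne_fold_pairs; first exact: bl_joinA.
- exact: bl_meetUl.
- exact: bl_meetUr.
- by move=> l k; rewrite /nf_meet ne_map_cat ne_fold_cat//; exact: bl_meetA.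
Qed.

Lemma lterm_nfE t :
  nf_eval T (lterm_nf t).1 = lterm_eval T t /\
  nf_eval T (lterm_nf t).2 = - lterm_eval T t.
Proof.
elim: t => [x|s IHs u IHu|a s IHs|s IHs u IHu] /=.
- by rewrite /nf_eval /nf_meet /= lin_mapN.
- case: (lterm_nf s) IHs => sp sn [/= <- hs]; case: (lterm_nf u) IHu => up un [/= <- hu].
  by rewrite !nf_evalD hs hu opprD.
- case: (lterm_nf s) IHs => sp sn [/= <- hs].
  case: ifPn => [a0|]; first by rewrite !nf_evalZ// hs scalerN.
  rewrite -ltNge => a0; have a0' : 0 <= - a by rewrite oppr_ge0 ltW.
  by rewrite !nf_evalZ// hs !scaleNr scalerN opprK.
- case: (lterm_nf s) IHs => sp sn [/= <- hs]; case: (lterm_nf u) IHu => up un [/= <- hu].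
  rewrite nf_eval_meet hs hu /bl_meet !opprK; split=> //.
  by rewrite /nf_eval ne_map_cat ne_fold_cat//; exact: bl_joinA.
Qed.

End NormalForm.

(** * Order and real-valued functionals *)

Section RealLattice.
Context {R : realType}.

Lemma maxrN (x : R) : Num.max x (- x) = `|x|.
Proof.
have [x0|x0] := ger0P x.
  by rewrite max_l// (le_trans _ x0)// oppr_le0.
by rewrite max_r// ltW// (lt_trans x0)// oppr_gt0.
Qed.

Fact real_joinD (x y z : R^o) : Num.max (x + z) (y + z) = Num.max x y + z.
Proof. by rewrite addr_maxl. Qed.

Fact real_joinZ (a : R) (x y : R^o) : 0 <= a ->
  Num.max (a *: x) (a *: y) = a *: Num.max x y.
Proof. by move=> a0; rewrite /GRing.scale/= maxr_pMr. Qed.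

Fact real_normM (x y : R^o) :
  Num.max (Num.max x (- x)) (Num.max y (- y)) = Num.max y (- y) -> `|x| <= `|y|.
Proof. by rewrite !maxrN => <-; rewrite le_max lexx. Qed.

Definition real_BL : BanachLattice R :=
  @BanachLatticeMk R R^o (fun x y : R => Num.max x y)
    (fun x y => maxC x y) (fun x y z => maxA x y z) (fun x => maxxx x)
    real_joinD real_joinZ real_normM.

(** Evaluation in [real_BL], unfolded to the operations of [R] so that real arithmetic applies
    directly. *)
Fixpoint reval (E : Type) (f : E -> R) (t : lterm (R := R) E) : R :=
  match t with
  | LVar x => f x
  | LAdd s u => reval f s + reval f u
  | LScale a s => a * reval f s
  | LJoin s u => Num.max (reval f s) (reval f u)
  end.

Lemma revalE (E : Type) (f : E -> R) t : lterm_eval (X := real_BL) f t = reval f t.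
Proof. by elim: t => //= [s -> u ->|a s ->|s -> u ->]. Qed.

Definition lin_form (V : lmodType R) (f : V -> R) : Prop :=
  forall a x y, f (a *: x + y) = a * f x + f y.

Section LinForm.
Context {V : lmodType R} (f : V -> R).
Hypothesis lf : lin_form f.
Let lf' : @lin_map R V R^o f := lf.

Lemma lin_form0 : f 0 = 0. Proof. exact: (lin_map0 lf'). Qed.

Lemma lin_formZ a x : f (a *: x) = a * f x. Proof. exact: (lin_mapZ lf'). Qed.

Lemma lin_formN x : f (- x) = - f x. Proof. exact: (lin_mapN lf'). Qed.

Lemma lin_formB x y : f (x - y) = f x - f y. Proof. exact: (lin_mapB lf'). Qed.

Lemma lin_form_sum (I : finType) (F : I -> V) : f (\sum_i F i) = \sum_i f (F i).
Proof. exact: (lin_map_sum lf'). Qed.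

End LinForm.

End RealLattice.

(** * Transfer of inequalities from linear functionals to Banach lattices *)

Section Transfer.
Context {R : realType} {Y : BanachLattice R}.

Definition positive_form (f : Y -> R) : Prop :=
  lin_form f /\ forall y, bl_le 0 y -> 0 <= f y.

Lemma positive_form_le f x y : positive_form f -> bl_le x y -> f x <= f y.
Proof.
move=> [lf f0] /bl_subr_ge0/f0.
by rewrite (lin_formB lf) subr_ge0.
Qed.

Lemma bl_pos_subadd (u v : Y) : bl_le (bl_join (u + v) 0) (bl_join u 0 + bl_join v 0).
Proof.
apply: bl_leUx; first by apply: bl_leD; exact: bl_leUl.
by rewrite -[0]addr0; apply: bl_leD; rewrite ?addr0; exact: bl_leUr.
Qed.

(** Hahn-Banach for [q v = |v^+|]: a linear [f <= q] is positive because [q (- y) = 0] for [y >= 0],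
    and [f w = |w^+|] then forces [w^+ = 0]. *)
Lemma positive_forms_separate (w : Y) :
  (forall f, positive_form f -> f w <= 0) -> bl_le w 0.
Proof.
move=> H; pose q (v : Y) : R := `|bl_join v 0|.
have sq : sublinear_on [set: Y] q.
  split=> [u v _ _|a u a0 _].
    apply: le_trans (ler_normD _ _); apply: bl_norm_le (bl_pos_subadd u v) _.
    apply: (@bl_le_trans _ _ 0); first by apply: bl_oppr_le0; exact: bl_leUr.
    by rewrite -[0]addr0; apply: bl_leD; rewrite ?addr0; exact: bl_leUr.
  by rewrite /q -{1}[0](scaler0 _ a) bl_joinZ ?ltW// normrZ gtr0_norm.
have [//|//|f [lf fq fw]] := hahn_banach (W := [set: Y]) _ sq (v0 := w) _.
have pf : positive_form f.
  split=> [a x y|y y0]; first exact: lf.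
  have := fq (- y) I; have := bl_oppr_le0 y0; rewrite /bl_le /q => ->.
  by rewrite normr0 lin_formN ?oppr_le0// => a x y'; exact: lf.
have := H f pf; rewrite fw /q normr_le0 => /eqP.
by rewrite /bl_le.
Qed.

(** A positive functional need not preserve meets, but on a meet it is at most the minimum of its
    values. That minimum is at most the real value of the term, so each meet of the normal form lies
    below [z], and so does their join. *)
Lemma lterm_eval_le (E : lmodType R) (T : E -> Y) t z : lin_map T ->
  (forall f, positive_form f -> reval (f \o T) t <= f z) ->
  bl_le (lterm_eval T t) z.
Proof.
move=> lT H; rewrite -(lterm_nfE lT t).1.
have {}H f m : positive_form f -> ne_in m (lterm_nf t).1 ->
    ne_fold Num.min (ne_map (f \o T) m) <= f z.
  move=> pf; have lfT : @lin_map R E R^o (f \o T).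
    by move=> a x y; rewrite /= lT pf.1.
  have := H f pf; rewrite -revalE -(lterm_nfE (X := real_BL) lfT t).1 /nf_eval.
  have mE k : nf_meet (X := real_BL) (f \o T) k = ne_fold Num.min (ne_map (f \o T) k).
    rewrite /nf_meet; elim: k => //= a k ->.
    by rewrite /bl_meet /= -oppr_min opprK.
  elim: (lterm_nf t).1 => [k|k P IH] /=; rewrite mE.
    by move=> + <-.
  by rewrite ge_max => /andP[kz /IH Pz] [<-//|/Pz].
have {}H m : ne_in m (lterm_nf t).1 -> bl_le (nf_meet T m) z.
  move=> mP; apply/bl_subr_le0/positive_forms_separate => f pf.
  rewrite (lin_formB pf.1) subr_le0.
  apply: le_trans (H f m pf mP); elim: m {mP} => //= a m IH.
  rewrite le_min; apply/andP; split.
    by apply: positive_form_le => //; exact: bl_leIl.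
  by apply: le_trans IH; apply: positive_form_le => //; exact: bl_leIr.
rewrite /nf_eval; elim: (lterm_nf t).1 H => [k|k P IH] /= H; first exact: H.
apply: bl_leUx; first by apply: H; left.
by apply: IH => m mP; apply: H; right.
Qed.

(** The difference of the two terms is compared with the vector 0, and [f \o T] is a linear form on
    [E]. *)
Lemma lterm_le_transfer (E : lmodType R) (T : E -> Y) s t : lin_map T ->
  (forall f, lin_form f -> reval f s <= reval f t) ->
  bl_le (lterm_eval T s) (lterm_eval T t).
Proof.
move=> lT H; apply/bl_subr_le0.
have -> : lterm_eval T s - lterm_eval T t = lterm_eval T (LAdd s (LScale (-1) t)).
  by rewrite /= scaleN1r.
apply: lterm_eval_le => // f [lf f0] /=.
rewrite (lin_form0 lf) mulN1r subr_le0; apply: H.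
by move=> a x y /=; rewrite lT lf.
Qed.

Lemma lterm_eq_transfer (E : lmodType R) (T : E -> Y) s t : lin_map T ->
  (forall f, lin_form f -> reval f s = reval f t) ->
  lterm_eval T s = lterm_eval T t.
Proof.
by move=> lT H; apply: bl_le_anti; apply: lterm_le_transfer => // f lf; rewrite H.
Qed.

End Transfer.

(** * The element (sum |x_i|^p)^(1/p) of a Banach lattice *)

(** Rounding goes towards zero on the grid of step [1 / (m + 1)] in [[-1, 1]], so that absolute
    values never grow and rounded points stay in the dual ball. The index is shifted by [m + 1] to
    cover negative values. *)
Lemma grid_round {R : realType} (m : nat) (a : R) : `|a| <= 1 ->
  exists k : 'I_(m.+1 + m.+1).+1, let b := (k%:R - m.+1%:R) / m.+1%:R in
    `|b| <= `|a| /\ `|a - b| <= m.+1%:R^-1.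
Proof.
move=> a1; have N0 : 0 < m.+1%:R :> R by rewrite ltr0n.
have := truncn_itv (mulr_ge0 (ltW N0) (normr_ge0 a)).
set r := Num.truncn _ => /andP[r1 r2].
have rm : (r <= m.+1)%N.
  by rewrite -(ler_nat R) (le_trans r1)// -[leRHS]mulr1 ler_pM2l.
have ra : r%:R / m.+1%:R <= `|a| by rewrite ler_pdivrMr// mulrC.
have ar : `|a| - r%:R / m.+1%:R <= m.+1%:R^-1.
  rewrite -(ler_pM2l N0) mulrBr mulrCA !divff ?gt_eqF// mulr1 lerBlDl.
  by rewrite natr1 ltW.
have r0 : 0 <= r%:R / m.+1%:R :> R by rewrite divr_ge0// ltW.
have [a0|a0] := lerP 0 a.
  have k_lt : (m.+1 + r < (m.+1 + m.+1).+1)%N by rewrite ltnS leq_add2l.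
  exists (Ordinal k_lt) => /=; rewrite natrD addrAC subrr add0r.
  rewrite (ger0_norm r0) ra; split=> //.
  by rewrite ger0_norm ?subr_ge0; move: ra ar; rewrite ger0_norm.
have k_lt : (m.+1 - r < (m.+1 + m.+1).+1)%N.
  by rewrite ltnS (leq_trans (leq_subr _ _))// leq_addr.
exists (Ordinal k_lt) => /=; rewrite natrB// addrAC subrr add0r mulNr normrN.
rewrite (ger0_norm r0) ra; split=> //.
rewrite opprK ler0_norm; last by move: ra; rewrite ltr0_norm// lerNr -subr_le0 opprK.
by rewrite opprD; move: ar; rewrite ltr0_norm.
Qed.

Fixpoint ne_of_seq {A : Type} (a : A) (s : seq A) : ne A :=
  if s is b :: s' then More b (ne_of_seq a s') else One a.

Lemma ne_in_of_seq {A : eqType} (a b : A) s :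
  ne_in b (ne_of_seq a s) <-> b = a \/ b \in s.
Proof.
elim: s => [|c s IH] /=; first by rewrite in_nil; split=> [->|[->|//]]; [left|].
rewrite IH in_cons; split=> [[->|[->|h]]|[->|/orP[/eqP->|h]]].
- by right; rewrite eqxx.
- by left.
- by right; rewrite h orbT.
- by right; left.
- by left.
- by right; right.
Qed.

Section PSum.
Context {R : realType} (p : R).
Hypothesis p1 : 1 < p.

Definition dual_ball (n : nat) : set ('I_n -> R) :=
  [set a | \sum_(i < n) `|a i| `^ conj_exp p <= 1].

Lemma dual_ball0 n : dual_ball (fun _ : 'I_n => 0).
Proof.
rewrite /dual_ball /= big1// => i _.
by rewrite normr0 powR0// gt_eqF// conj_exp_gt0.
Qed.

Lemma dual_ball_sub n (a b : 'I_n -> R) :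
  (forall i, `|b i| <= `|a i|) -> dual_ball a -> dual_ball b.
Proof.
move=> ba; apply: le_trans; apply: ler_sum => i _.
by apply: ge0_ler_powR; rewrite ?nnegrE// ltW// conj_exp_gt0.
Qed.

Lemma dual_ball_le1 n (a : 'I_n -> R) i : dual_ball a -> `|a i| <= 1.
Proof.
move=> ha; rewrite leNgt; apply/negP => a1.
have q0 := conj_exp_gt0 p1.
have : 1 `^ conj_exp p < `|a i| `^ conj_exp p.
  by apply: gt0_ltr_powR; rewrite ?nnegrE.
rewrite powR1; apply/negP; rewrite -leNgt (le_trans _ ha)// (bigD1 i)//= lerDl.
by apply: sumr_ge0 => j _; exact: powR_ge0.
Qed.

Lemma dual_ball_net n (m : nat) : exists L : ne ('I_n -> R),
  (forall b, ne_in b L -> dual_ball b) /\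
  (forall a, dual_ball a -> exists2 b, ne_in b L &
     forall i, `|a i - b i| <= m.+1%:R^-1).
Proof.
pose g (k : 'I_(m.+1 + m.+1).+1) : R := (k%:R - m.+1%:R) / m.+1%:R.
pose h (k : {ffun 'I_n -> 'I_(m.+1 + m.+1).+1}) : {ffun 'I_n -> R} :=
  [ffun i => g (k i)].
pose ball (b : {ffun 'I_n -> R}) := \sum_(i < n) `|b i| `^ conj_exp p <= 1.
(* The zero vector makes the list non-empty; finite functions make the grid enumerable. *)
pose L := ne_of_seq [ffun=> 0] [seq b <- [seq h k | k <- enum predT] | ball b].
have inL (b : 'I_n -> R) : ne_in b (ne_map (fun c : {ffun _} => c : 'I_n -> R) L) <->
    exists2 c : {ffun 'I_n -> R}, ne_in c L & b = c.
  elim: L => [c|c l IH] /=.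
    by split=> [<-|[_ <- ->//]]; exists c.
  split=> [[<-|/IH[d dl ->]]|[d [->|dl] bd]].
  - by exists c => //; left.
  - by exists d => //; right.
  - by left; rewrite bd.
  - by right; apply/IH; exists d.
exists (ne_map (fun c : {ffun _} => c : 'I_n -> R) L); split.
  move=> b /inL[c /ne_in_of_seq[->|cL] ->].
    by apply: dual_ball_sub (dual_ball0 n) => i; rewrite ffunE.
  by move: cL; rewrite mem_filter => /andP[].
move=> a ha.
have /choice[k hk] i := grid_round m (dual_ball_le1 i ha).
exists (h (finfun k)); last by move=> i; rewrite !ffunE; exact: (hk i).2.
apply/inL; exists (h (finfun k)) => //; apply/ne_in_of_seq; right.
rewrite mem_filter; apply/andP; split.
  by apply: dual_ball_sub ha => i; rewrite !ffunE; exact: (hk i).1.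
by apply: map_f; rewrite mem_enum.
Qed.

Context {X : BanachLattice R}.

Definition lincomb n (x : 'I_n -> X) (a : 'I_n -> R) : X := \sum_(i < n) a i *: x i.

Lemma lincomb_approx n (x : 'I_n -> X) (a b : 'I_n -> R) (e : R) :
  (forall i, `|a i - b i| <= e) ->
  bl_le (lincomb x a) (lincomb x b + e *: \sum_i bl_abs (x i)).
Proof.
move=> ab; rewrite /lincomb scaler_sumr -big_split/=; apply: bl_sum_le => i.
rewrite -{1}(subrK (b i) (a i)) scalerDl [X in bl_le _ X]addrC; apply: bl_leD2r.
apply: (@bl_le_trans _ _ (`|a i - b i| *: bl_abs (x i))); last first.
  by apply: bl_scale2r (ab i); exact: bl_abs_ge0.
have [c0|c0] := ger0P (a i - b i).
  by apply: bl_leZ => //; exact: bl_le_abs.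
rewrite -{1}[_ - _]opprK scaleNr -scalerN; apply: bl_leZ; last exact: bl_leN_abs.
by rewrite oppr_ge0 ltW.
Qed.

Lemma ne_fold_join_ub (A : Type) (h : A -> X) (L : ne A) a :
  ne_in a L -> bl_le (h a) (ne_fold (@bl_join R X) (ne_map h L)).
Proof.
elim: L => [b|b L IH] /= => [->|[->|/IH aL]]; first exact: bl_lexx.
  exact: bl_leUl.
by apply: bl_le_trans aL _; exact: bl_leUr.
Qed.

Lemma ne_fold_join_lub (A : Type) (h : A -> X) (L : ne A) z :
  (forall a, ne_in a L -> bl_le (h a) z) ->
  bl_le (ne_fold (@bl_join R X) (ne_map h L)) z.
Proof.
elim: L => [b|b L IH] /= H; first exact: H.
by apply: bl_leUx; [apply: H; left|apply: IH => a aL; apply: H; right].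
Qed.

(** Finite joins approximate the p-sum with an error proportional to [\sum_i |x_i|]. The clauses
    speak of upper bounds only, so they can be used to construct the supremum as well as to
    approximate a given one. *)
Lemma psum_net n (x : 'I_n -> X) (m : nat) : exists L : ne ('I_n -> R),
  let z := ne_fold (@bl_join R X) (ne_map (lincomb x) L) in
  [/\ forall b, ne_in b L -> dual_ball b,
      forall a, dual_ball a ->
        bl_le (lincomb x a) (z + m.+1%:R^-1 *: \sum_i bl_abs (x i)) &
      forall w, (forall a, dual_ball a -> bl_le (lincomb x a) w) -> bl_le z w].
Proof.
have [L [Lb La]] := dual_ball_net n m; exists L; split=> // [a /La[b bL ab]|w H].
  apply: bl_le_trans (lincomb_approx x ab) _; apply: bl_leD2r.
  exact: ne_fold_join_ub.
by apply: ne_fold_join_lub => a /Lb; exact: H.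
Qed.

(** The joins over finer and finer nets differ by at most [e / (m + 1)] in either direction, hence
    form a Cauchy sequence; closedness of the order makes the limit the supremum. *)
Lemma psum_exists n (x : 'I_n -> X) : exists z : X,
  bl_is_lub [set \sum_(i < n) a i *: x i | a in dual_ball (n := n)] z.
Proof.
have /choice[L HL] := psum_net x.
pose z m := ne_fold (@bl_join R X) (ne_map (lincomb x) (L m)).
pose e := \sum_i bl_abs (x i).
have e0 : bl_le 0 e by exact: bl_sum_abs_ge0.
have zz m k : bl_le (z m) (z k + k.+1%:R^-1 *: e).
  by have [_ _] := HL m; apply => a; have [_ + _] := HL k; apply.
have nz m k : (m <= k)%N -> `|z m - z k| <= m.+1%:R^-1 * `|e|.
  move=> mk; rewrite -[m.+1%:R^-1]ger0_norm ?invr_ge0// -normrZ.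
  apply: bl_norm_le.
    have := bl_leD2r (- z k) (zz m k); rewrite addrAC subrr add0r => h.
    apply: bl_le_trans h _; apply: bl_scale2r => //.
    by rewrite lef_pV2 ?posrE// ler_nat.
  by have := bl_leD2r (- z m) (zz k m); rewrite addrAC subrr add0r opprB.
have small (d : R) : 0 < d -> exists m, m.+1%:R^-1 * `|e| < d.
  move=> d0; exists (Num.truncn (`|e| / d)).
  rewrite mulrC ltr_pdivrMr// mulrC -ltr_pdivrMr//.
  by have /andP[] := truncn_itv (divr_ge0 (normr_ge0 e) (ltW d0)).
have cz : cvgn z.
  apply/cauchy_cvgP/cauchy_exP => d d0; have [m md] := small d d0.
  exists (z m); exists m => // k /= mk.
  by rewrite -ball_normE /ball_ /=; apply: le_lt_trans md; exact: nz.
have zlim (d : R) : 0 < d -> exists m, m.+1%:R^-1 * `|e| <= d /\ `|z m - limn z| <= d.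
  move=> d0; have [m md] := small d d0; exists m; split; first exact: ltW.
  apply/ler_addgt0Pr => c c0.
  have /cvgrPdist_le/(_ c c0)[N _ NP] := cz.
  have := NP (maxn N m) (leq_maxl _ _); rewrite /= distrC => h.
  apply: le_trans (ler_distD (z (maxn N m)) _ _) _; apply: lerD h.
  exact: le_trans (nz m (maxn N m) (leq_maxr _ _)) (ltW md).
exists (limn z); split=> [_ [a ha <-]|w H].
  apply: bl_le_closed => d d0; have [m [md zd]] := zlim _ (divr_gt0 d0 (ltr0n _ 2)).
  exists (z m - limn z + m.+1%:R^-1 *: e).
    apply: le_trans (ler_normD _ _) _.
    by rewrite [leRHS]splitr lerD// normrZ ger0_norm ?invr_ge0.
  by rewrite addrA addrCA subrr addr0; have [_ + _] := HL m; apply.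
apply: bl_le_closed => d d0; have [m [md zd]] := zlim _ d0.
exists (limn z - z m); first by rewrite distrC.
rewrite -{1}(subrK (z m) (limn z)) addrC; apply: bl_leD2r.
have [_ _] := HL m; apply => a ha; apply: H.
by exists a.
Qed.

End PSum.

(** * Norming contractions into finite-dimensional l^p *)

Section Reval.
Context {R : realType} {E : lmodType R}.

Lemma revalZ (a : R) (f : E -> R) (t : lterm (R := R) E) : 0 <= a ->
  reval (fun x => a * f x) t = a * reval f t.
Proof.
move=> a0; elim: t => //= [s -> u ->|c s ->|s -> u ->].
- by rewrite mulrDr.
- by rewrite mulrCA.
- by rewrite maxr_pMr.
Qed.

(* On [A], every join occurring in the term always picks the same argument, so
   that the term is linear on [A]. *)
Fixpoint homogeneous_on (A : set (E -> R)) (t : lterm (R := R) E) : Prop :=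
  match t with
  | LVar _ => True
  | LAdd s u => homogeneous_on A s /\ homogeneous_on A u
  | LScale _ s => homogeneous_on A s
  | LJoin s u => [/\ homogeneous_on A s, homogeneous_on A u &
      (forall f, A f -> reval f s <= reval f u) \/
      (forall f, A f -> reval f u <= reval f s)]
  end.

Lemma homogeneous_onS (A B : set (E -> R)) t :
  A `<=` B -> homogeneous_on B t -> homogeneous_on A t.
Proof.
move=> AB; elim: t => //= [s IHs u IHu [/IHs ? /IHu ?] //|].
move=> s IHs u IHu [/IHs hs /IHu hu h]; split=> //.
by case: h => h; [left|right] => f /AB; exact: h.
Qed.

(** The label of [f] records the outcome of the comparison at each join of the term. *)
Lemma homogeneous_cells t : exists (I : finType) (lab : (E -> R) -> I),
  forall c, homogeneous_on [set f | lab f = c] t.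
Proof.
elim: t => [x|s [I [l hl]] u [J [m hm]]|a s IHs|s [I [l hl]] u [J [m hm]]].
- by exists unit, (fun=> tt).
- exists (I * J)%type, (fun f => (l f, m f)) => -[i j]; split.
    by apply: homogeneous_onS (hl i) => f [].
  by apply: homogeneous_onS (hm j) => f [].
- exact: IHs.
- exists (I * J * bool)%type, (fun f => (l f, m f, reval f s <= reval f u)).
  move=> [[i j] b]; split.
  + by apply: homogeneous_onS (hl i) => f [].
  + by apply: homogeneous_onS (hm j) => f [].
  + case: b; [left|right] => f [_ _]; first by [].
    by move=> /negbT; rewrite -ltNge => /ltW.
Qed.

End Reval.

Section Norming.
Context {R : realType} (p : R).
Hypothesis p1 : 1 < p.

Let p0 : 0 < p. Proof. exact: lt_trans p1. Qed.

Lemma ler1D_powR (x : R) : 0 <= x -> x <= 1 + x `^ p.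
Proof.
move=> x0; have [x1|/ltW x1] := lerP x 1.
  by apply: le_trans x1 _; rewrite lerDl powR_ge0.
by apply: le_trans (le1r_powR x1 (ltW p1)) _; rewrite lerDr.
Qed.

Section SumPow.
Context {E : lmodType R}.

Definition sum_pow (N : E -> R) (s : seq E) : R := \sum_(x <- s) N x `^ p.

Lemma sum_pow_ge0 N s : 0 <= sum_pow N s.
Proof. by apply: sumr_ge0 => x _; exact: powR_ge0. Qed.

Lemma sum_pow_cat N s1 s2 : sum_pow N (s1 ++ s2) = sum_pow N s1 + sum_pow N s2.
Proof. exact: big_cat. Qed.

(** The factor [a^(1/p)] multiplies p-th power sums by [a], so finite families behave like a
    cone. *)
Definition pscale (a : R) (s : seq E) : seq E := [seq a `^ p^-1 *: x | x <- s].

Lemma sum_pow_scale N a s : (forall c x, N (c *: x) = `|c| * N x) ->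
  (forall x, 0 <= N x) -> 0 <= a -> sum_pow N (pscale a s) = a * sum_pow N s.
Proof.
move=> NZ N0 a0; rewrite /sum_pow big_map mulr_sumr; apply: eq_bigr => x _.
by rewrite NZ powRM// ger0_norm ?powR_ge0// powRVpK.
Qed.

Lemma sum_pow_scale_form (f : E -> R) a s : lin_form f -> 0 <= a ->
  sum_pow (fun x => `|f x|) (pscale a s) = a * sum_pow (fun x => `|f x|) s.
Proof.
move=> lf a0; apply: sum_pow_scale => // c x.
by rewrite (lin_formZ lf) normrM.
Qed.

(** This makes the gauge finite. For a sum, the larger of the two values is doubled, which costs the
    factor [2^p]; for a join the two families are concatenated. *)
Lemma reval_dominated (t : lterm (R := R) E) : exists s, forall f, lin_form f ->
  `|reval f t| `^ p <= sum_pow (fun x => `|f x|) s.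
Proof.
elim: t => [x|t1 [s1 h1] t2 [s2 h2]|a t [s h]|t1 [s1 h1] t2 [s2 h2]].
- by exists [:: x] => f _; rewrite /sum_pow big_seq1.
- exists (pscale (2 `^ p) (s1 ++ s2)) => f lf.
  rewrite sum_pow_scale_form ?powR_ge0// sum_pow_cat /=.
  have le2 : forall x y : R, `|y| <= `|x| -> `|x + y| `^ p <= 2 `^ p * `|x| `^ p.
    move=> x y yx; rewrite -powRM//; apply: (ler_powRp p1) => //.
    by apply: le_trans (ler_normD _ _) _; lra.
  have [yx|/ltW xy] := lerP `|reval f t2| `|reval f t1|.
    apply: le_trans (le2 _ _ yx) _; rewrite ler_pM2l ?powR_gt0//.
    by apply: le_trans (h1 f lf) _; rewrite lerDl sum_pow_ge0.
  rewrite addrC; apply: le_trans (le2 _ _ xy) _; rewrite ler_pM2l ?powR_gt0//.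
  by apply: le_trans (h2 f lf) _; rewrite lerDr sum_pow_ge0.
- exists (pscale (`|a| `^ p) s) => f lf.
  rewrite sum_pow_scale_form ?powR_ge0//= normrM powRM//.
  by rewrite ler_wpM2l ?powR_ge0// h.
- exists (s1 ++ s2) => f lf; rewrite sum_pow_cat /=.
  have [_|_] := leP (reval f t1) (reval f t2).
    by apply: le_trans (h2 f lf) _; rewrite lerDr sum_pow_ge0.
  by apply: le_trans (h1 f lf) _; rewrite lerDl sum_pow_ge0.
Qed.

End SumPow.

(** Let [z] be the p-sum of the [T x_j]. A positive [f] satisfies [f z >= pnorm (f (T x_j)) >=
    |reval (f \o T) t|], because the p-norm is attained on the dual ball. Hence [z] dominates the
    value of [t] and its opposite, and p-convexity bounds [|z|]. *)
Lemma Cp_lterm_bound (E : normedModType R) (t : lterm (R := R) E) (s : seq E)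
    (Y : BanachLattice R) (T : E -> Y) :
  (forall f, lin_form f -> `|reval f t| `^ p <= sum_pow (fun x => `|f x|) s) ->
  Cp p Y -> lin_contraction T ->
  `|lterm_eval T t| `^ p <= sum_pow (fun x => `|x|) s.
Proof.
move=> H CY [lT Tc]; pose x i := tnth (in_tuple s) i.
have [z [zub zlub]] := psum_exists p1 (T \o x).
have fz f : positive_form f -> `|reval (f \o T) t| <= f z.
  move=> [lf f0]; have lfT : lin_form (f \o T).
    by move=> a u v /=; rewrite lT lf.
  apply: le_trans (_ : pnorm p (f \o T \o x) <= _).
    apply: (ler_powRpP p1) => //; first exact: pnorm_ge0.
    rewrite powR_pnorm//; apply: le_trans (H _ lfT) _.
    by rewrite /sum_pow big_tnth.
  have [a a1 <-] := pnorm_attained p1 (f \o T \o x).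
  rewrite -[leLHS](_ : f (\sum_i a i *: (T \o x) i) = _); last first.
    by rewrite (lin_form_sum lf); apply: eq_bigr => i _; rewrite (lin_formZ lf).
  by apply: (positive_form_le (conj lf f0)); apply: zub; exists a.
have tz : bl_le (lterm_eval T t) z.
  apply: lterm_eval_le => // f pf.
  by apply: le_trans (ler_norm _) _; exact: fz.
have Ntz : bl_le (- lterm_eval T t) z.
  have -> : - lterm_eval T t = lterm_eval T (LScale (-1) t) by rewrite /= scaleN1r.
  apply: lterm_eval_le => // f pf /=; rewrite mulN1r.
  by apply: le_trans (fz f pf); rewrite -normrN ler_norm.
have := CY _ _ _ (conj zub zlub) => nz.
apply: le_trans (_ : pnorm p (fun i => `|x i|) `^ p <= _); last first.
  rewrite powR_pnorm// /sum_pow [leRHS]big_tnth; apply: ler_sum => i _.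
  by rewrite normr_id.
apply: (ler_powRp p1 (normr_ge0 _)).
apply: (le_trans (bl_norm_le tz Ntz)).
apply: (le_trans nz); apply: (ler_powRVp p1).
  by apply: sumr_ge0 => i _; exact: powR_ge0.
apply: ler_sum => i _; rewrite normr_id; apply: (ler_powRp p1) => //.
exact: Tc.
Qed.

(* [K] carries the positive functional of Hahn-Banach for the gauge
   [q g = inf {sum |x_j|^p : g <= sum |f x_j|^p on K}].  Normalising [|f_t| = 1]
   on [K] makes averaging over a cell lose nothing. *)
Lemma lp_norming (E : normedModType R) (t : lterm (R := R) E) :
  exists (I : finType) (s : I -> E -> R) (Q : R),
   [/\ forall i, lin_form (s i), forall x, \sum_i `|s i x| `^ p <= `|x| `^ p,
       \sum_i `|reval (s i) t| `^ p = Q &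
       forall (Y : BanachLattice R) (T : E -> Y), Cp p Y -> lin_contraction T ->
         `|lterm_eval T t| `^ p <= Q].
Proof.
pose K := [set f : E -> R | lin_form f /\ `|reval f t| = 1].
pose sp (f : E -> R) := sum_pow (fun x => `|f x|).
pose dom (g : (E -> R) -> R) : set (seq E) :=
  [set s | forall f, K f -> g f <= sp f s].
pose W : set ((E -> R) -> R) :=
  [set g | exists s, forall f, K f -> `|g f| <= sp f s].
have Wle g h : W h -> (forall f, K f -> `|g f| <= `|h f|) -> W g.
  by move=> [s hs] gh; exists s => f Kf; apply: le_trans (gh f Kf) (hs f Kf).
have WP a (g h : (E -> R) -> R) : W g -> W h -> W (a *: g + h).
  move=> [s hs] [r hr]; exists (pscale `|a| s ++ r) => f Kf.
  rewrite /sp sum_pow_cat sum_pow_scale_form//; last exact: Kf.1.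
  apply: le_trans (ler_normD _ _) _; apply: lerD; last exact: hr.
  by rewrite normrM ler_wpM2l// hs.
(* On [K] the constant 1 equals [|f_t|^p], which a finite family dominates. *)
have W1 : W (fun=> 1).
  have [s hs] := reval_dominated t; exists s => f [lf f1].
  by have := hs f lf; rewrite f1 powR1 normr1.
have Wpow (r : lterm (R := R) E) : W (fun f => `|reval f r| `^ p).
  have [s hs] := reval_dominated r; exists s => f [lf f1].
  by rewrite ger0_norm ?powR_ge0//; exact: hs.
have Weval (r : lterm (R := R) E) : W (fun f => reval f r).
  apply: Wle (WP 1 _ _ W1 (Wpow r)) _ => f Kf.
  rewrite [leRHS](_ : _ = `|1 + `|reval f r| `^ p|).
    by rewrite [leRHS]ger0_norm ?addr_ge0 ?powR_ge0// ler1D_powR.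
  by congr (`|_|); rewrite [LHS](_ : _ = 1 * 1 + `|reval f r| `^ p)// mul1r.
pose q g := inf [set sum_pow (fun x : E => `|x|) s | s in dom g].
have sq : sublinear_on W q.
  apply: (@inf_sublinear_on _ _ W WP _ dom (fun s _ => sum_pow (fun x : E => `|x|) s)
    (fun=> 0)).
  - move=> g [s hs]; exists s => f Kf; apply: le_trans (hs f Kf).
    exact: ler_norm.
  - by move=> *; exact: sum_pow_ge0.
  - move=> s r g h gs hr _ _; exists (s ++ r); last by rewrite sum_pow_cat.
    by move=> f Kf; rewrite /sp sum_pow_cat; apply: lerD; [exact: gs|exact: hr].
  - move=> a s g a0 gs _; exists (pscale a s).
      move=> f Kf; rewrite /sp sum_pow_scale_form ?(ltW a0)//; last exact: Kf.1.
      by rewrite [leLHS](_ : _ = a * g f)// ler_pM2l// gs.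
    rewrite sum_pow_scale// ?(ltW a0)// => c x.
    exact: normrZ.
(* [phi] plays the part of an integral of total mass [q 1], which will be the constant [Q]. *)
have [phi [phiL phiq phi1]] := hahn_banach WP sq W1.
have qle g s : dom g s -> q g <= sum_pow (fun x : E => `|x|) s.
  move=> gs; apply: ge_inf; last by exists s.
  by exists 0 => _ [r _ <-]; exact: sum_pow_ge0.
(* Positivity of [phi]: the empty family dominates every function that is non-positive on [K]. *)
have phi_le0 g : W g -> (forall f, K f -> g f <= 0) -> phi g <= 0.
  move=> Wg g0; apply: le_trans (phiq g Wg) _.
  apply: le_trans (qle g [::] _) _; last by rewrite /sum_pow big_nil.
  by move=> f Kf; rewrite /sp /sum_pow big_nil g0.
have phi_le g h : W g -> W h -> (forall f, K f -> g f <= h f) -> phi g <= phi h.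
  move=> Wg Wh gh; have := phi_le0 (-1 *: h + g) (WP _ _ _ Wh Wg).
  rewrite phiL// mulN1r => H; rewrite -subr_le0 addrC; apply: H => f Kf.
  by rewrite [leLHS](_ : _ = -1 * h f + g f)// mulN1r addrC subr_le0 gh.
have phi_eq g h : W g -> W h -> (forall f, K f -> g f = h f) -> phi g = phi h.
  by move=> Wg Wh gh; apply/eqP; rewrite eq_le !phi_le// => f Kf; rewrite gh.
have W0 : W 0.
  by exists [::] => f _; rewrite /sp /sum_pow big_nil normr0.
have phi0 : phi 0 = 0.
  by have := phiL 1 0 0 W0 W0; rewrite scale1r addr0 mul1r; lra.
have phi_sum (J : finType) (G : J -> (E -> R) -> R) : (forall j, W (G j)) ->
    W (\sum_j G j) /\ phi (\sum_j G j) = \sum_j phi (G j).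
  move=> WG; apply: (big_ind2 (fun g a => W g /\ phi g = a)) => //.
  move=> g a h b [Wg <-] [Wh <-]; rewrite -[g]scale1r phiL// mul1r scale1r.
  by split=> //; rewrite -[g]scale1r; exact: WP.
(* The cells are taken for [|t|] rather than [t], so that the sign of [f_t] is also constant on each
   of them and no cancellation occurs under [phi]. *)
pose tt' := LJoin t (LScale (-1) t).
have tt'E f : reval f tt' = `|reval f t| by rewrite /= mulN1r maxrN.
have [I [lab hom]] := homogeneous_cells tt'.
pose ind (c : I) (f : E -> R) : R := (lab f == c)%:R.
have ind01 c f : 0 <= ind c f <= 1 by rewrite /ind; case: eqP; rewrite lexx ler01.
have ind_ge0 c f : 0 <= ind c f by have /andP[] := ind01 c f.
have Wind c g : W g -> W (fun f => ind c f * g f).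
  move=> Wg; apply: Wle Wg _ => f _; have /andP[i0 i1] := ind01 c f.
  by rewrite normrM ger0_norm// -[leRHS]mul1r ler_wpM2r.
have ind_sum g : W g -> \sum_c phi (fun f => ind c f * g f) = phi g.
  move=> Wg; have [Ws <-] := phi_sum I _ (fun c => Wind c g Wg).
  apply: phi_eq => // f Kf.
  rewrite fct_sumE (bigD1 (lab f))//= /ind eqxx mul1r big1 ?addr0// => c cf.
  by rewrite eq_sym (negbTE cf) mul0r.
(* The unnormalised barycentre of the functionals in cell [c]. *)
pose phic c x := phi (fun f => ind c f * f x).
have phic_lin c : lin_form (phic c).
  move=> a x y; rewrite /phic -phiL; [|exact: Wind (Weval (LVar x))|
    exact: Wind (Weval (LVar y))].
  apply: phi_eq => [||f Kf].
  - apply: Wle (Wind c _ (Weval (LVar (a *: x + y)))) _ => f _ //.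
  - by apply: WP; [exact: Wind (Weval (LVar x))|exact: Wind (Weval (LVar y))].
  - rewrite [RHS](_ : _ = a * (ind c f * f x) + ind c f * f y)// Kf.1.
    by ring.
(* A term that is linear on the cell commutes with averaging over it. *)
have phic_eval c r : homogeneous_on [set f | lab f = c] r ->
    reval (phic c) r = phi (fun f => ind c f * reval f r).
  elim: r => [x _|r1 IH1 r2 IH2 /= [h1 h2]|a r IH /= h|r1 IH1 r2 IH2 /= [h1 h2 h]].
  - by [].
  - rewrite IH1// IH2// -[phi _]mul1r -phiL; try exact: Wind (Weval _).
    apply: phi_eq; [|exact: Wind (Weval (LAdd r1 r2))|].
      by apply: WP; exact: Wind (Weval _).
    move=> f Kf.
    rewrite [LHS](_ : _ = 1 * (ind c f * reval f r1) + ind c f * reval f r2)//.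
    by ring.
  - rewrite IH// -[LHS]addr0 -phi0 -phiL//; last exact: Wind (Weval _).
    apply: phi_eq; [|exact: Wind (Weval (LScale a r))|].
      by apply: WP => //; exact: Wind (Weval _).
    by move=> f Kf; rewrite [LHS](_ : _ = a * (ind c f * reval f r) + 0)//; ring.
  - rewrite IH1// IH2//.
    have key u v : (forall f, lab f = c -> reval f u <= reval f v) ->
        phi (fun f => ind c f * reval f u) <= phi (fun f => ind c f * reval f v) /\
        phi (fun f => ind c f * reval f v) =
        phi (fun f => ind c f * Num.max (reval f u) (reval f v)).
      move=> uv; split.
        apply: phi_le; [exact: Wind (Weval u)|exact: Wind (Weval v)|].
        move=> f Kf; rewrite /ind; case: eqP => [/uv ?|_]; last by rewrite !mul0r.
        by rewrite !mul1r.
      apply: phi_eq; [exact: Wind (Weval v)|exact: Wind (Weval (LJoin u v))|].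
      move=> f Kf; rewrite /ind; case: eqP => [/uv ?|_]; last by rewrite !mul0r.
      by rewrite !mul1r max_r.
    case: h => h; have [le eq] := key _ _ h.
      by rewrite max_r.
    rewrite max_l// eq//; congr phi; apply/funext => f.
    by rewrite maxC.
pose mu c := phi (ind c).
have Wic c : W (ind c).
  by apply: Wle (Wind c _ W1) _ => f _; rewrite mulr1.
have mu_ge0 c : 0 <= mu c.
  rewrite -phi0; apply: phi_le => [//|//|f _].
  exact: ind_ge0.
have mu_sum : \sum_c mu c = q (fun=> 1).
  rewrite -phi1 -(ind_sum _ W1); apply: eq_bigr => c _.
  by congr phi; apply/funext => f; rewrite mulr1.
have phic_t c : `|reval (phic c) t| = mu c.
  rewrite -tt'E phic_eval//; apply: phi_eq => //.
    exact: Wind (Weval tt').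
  by move=> f [_ f1]; rewrite tt'E f1 mulr1.
(* The barycentre is divided by the mass and weighted by [mu^(1/p)], so that the p-th power of its
   value on [t] is again [mu c]. A cell of mass 0 gets weight 0, as the exponent is non-zero. *)
pose w c := mu c `^ (p^-1 - 1).
have w_ge0 c : 0 <= w c by exact: powR_ge0.
have pV1 : p^-1 - 1 != 0.
  by rewrite subr_eq0 -[X in _ != X]invr1 (inj_eq invr_inj) gt_eqF.
have wp c : 0 < mu c -> w c `^ p * mu c `^ p = mu c.
  move=> m0; rewrite -powRM ?mu_ge0// /w -[X in _ * X]powRr1 ?mu_ge0//.
  by rewrite -powRD ?subrK ?invr_eq0 ?gt_eqF// powRVpK// mu_ge0.
have jensen c x : `|w c * phic c x| `^ p <= phi (fun f => ind c f * `|f x| `^ p).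
  have B0 : 0 <= phi (fun f => ind c f * `|f x| `^ p).
    rewrite -phi0; apply: phi_le => //; first exact: Wind (Wpow (LVar x)).
    by move=> f _; rewrite mulr_ge0 ?powR_ge0.
  have := mu_ge0 c; rewrite le_eqVlt => /predU1P[m0|m0].
    by rewrite /w -m0 powR0// mul0r normr0 powR0// gt_eqF.
  pose absx : (E -> R) -> R := fun f => ind c f * `|f x|.
  have Wabs : W absx.
    apply: Wle (Wind c _ (Weval (LVar x))) _ => f _.
    by rewrite /absx /= !normrM normr_id.
  pose m := phi absx / mu c.
  have A0 : 0 <= phi absx.
    rewrite -phi0; apply: phi_le => // f _; by rewrite /absx mulr_ge0.
  have m_ge0 : 0 <= m by rewrite divr_ge0// mu_ge0.
  have lin : mu c * m `^ p <= phi (fun f => ind c f * `|f x| `^ p).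
    (* Jensen's inequality by integrating the tangent of [x^p] at the mean [m] of [|f x|] over the
       cell; the first-order term has integral 0. *)
    pose k := p * m `^ (p - 1).
    have -> : mu c * m `^ p = phi ((m `^ p - k * m) *: ind c + (k *: absx + 0)).
      rewrite phiL//; last exact: WP.
      rewrite phiL// phi0 -/(mu c) /m; field.
      by rewrite gt_eqF.
    apply: phi_le; [by apply: (WP _ _ _) => //; exact: WP|exact: Wind (Wpow (LVar x))|].
    move=> f Kf; rewrite [leLHS](_ : _ = (m `^ p - k * m) * ind c f + (k * absx f + 0))//.
    rewrite [leLHS](_ : _ = ind c f * (m `^ p + k * (`|f x| - m))); last first.
      by rewrite /absx; ring.
    by apply: (ler_wpM2l (ind_ge0 c f)); exact: powR_tangent.
  apply: le_trans lin; rewrite -[X in X * _ `^ _]wp// -mulrA -powRM ?mu_ge0//.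
  rewrite /m [mu c * _]mulrC divfK ?gt_eqF// -powRM// normrM (ger0_norm (w_ge0 c)).
  apply: (ler_powRp p1); first by rewrite mulr_ge0.
  rewrite ler_wpM2l//; rewrite ler_norml; apply/andP; split.
    rewrite lerNl -[X in X <= _](_ : phi (-1 *: (fun f => ind c f * f x) + 0) = _).
      apply: phi_le => //; first by apply: WP => //; exact: Wind (Weval (LVar x)).
      move=> f _; rewrite [leLHS](_ : _ = -1 * (ind c f * f x) + 0)//.
      rewrite addr0 mulrCA /absx; apply: (ler_wpM2l (ind_ge0 c f)).
      by rewrite mulN1r -normrN ler_norm.
    by rewrite phiL ?phi0 ?addr0 ?mulN1r//; exact: Wind (Weval (LVar x)).
  apply: phi_le => //; first exact: Wind (Weval (LVar x)).
  by move=> f _; rewrite /absx ler_wpM2l ?ler_norm.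
exists I, (fun c x => w c * phic c x), (q (fun=> 1)); split.
- by move=> c a x y; rewrite phic_lin; ring.
- move=> x; apply: le_trans (ler_sum _ (fun c _ => jensen c x)) _.
  rewrite (ind_sum _ (Wpow (LVar x))); apply: le_trans (phiq _ (Wpow (LVar x))) _.
  apply: le_trans (qle _ [:: x] _) _; last by rewrite /sum_pow big_seq1.
  by move=> f Kf; rewrite /sp /sum_pow big_seq1.
- rewrite -mu_sum; apply: eq_bigr => c _.
  rewrite revalZ// normrM phic_t (ger0_norm (w_ge0 c)).
  have := mu_ge0 c; rewrite le_eqVlt => /predU1P[m0|m0].
    by rewrite -m0 mulr0 powR0// gt_eqF.
  by rewrite powRM ?mu_ge0// wp.
- move=> Y T CY cT; apply: lb_le_inf.
    have [s hs] := W1; exists (sum_pow (fun x : E => `|x|) s), s => // f Kf.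
    by apply: le_trans (hs f Kf); exact: ler_norm.
  move=> _ [s hs <-]; apply: Cp_lterm_bound => // f lf.
  (* The domination is known on [K] only; dividing [f] by [|f_t|] extends it by homogeneity, and the
     case [f_t = 0] is immediate. *)
  have := normr_ge0 (reval f t); rewrite le_eqVlt => /predU1P[f0|f0].
    by rewrite -f0 powR0 ?gt_eqF// sum_pow_ge0.
  set k := `|reval f t|; have k0 : 0 <= k^-1 by rewrite invr_ge0 normr_ge0.
  have Kf : K (fun x => k^-1 * f x).
    split=> [a x y|]; first by rewrite lf; ring.
    by rewrite (revalZ _ _ k0) normrM (ger0_norm k0) mulVf// gt_eqF.
  have := hs _ Kf; rewrite /sp /sum_pow.
  rewrite (eq_bigr (fun x => (k `^ p)^-1 * `|f x| `^ p)); last first.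
    move=> x _; rewrite normrM (ger0_norm k0) powRM//.
    by rewrite powR_inv ?normr_ge0.
  by rewrite -mulr_sumr ler_pdivlMl ?powR_gt0// mulr1.
Qed.

End Norming.

(** * Finitely supported sequences and comparison of the two norms *)

Section FiniteSequences.
Context {R : realType} (p : R).
Hypothesis p1 : 1 < p.

Definition ext_seq n (v : 'I_n -> R) : R ^nat := fun k => oapp v 0 (insub k).

Lemma series_ext_seq n (v : 'I_n -> R) m : (n <= m)%N ->
  series (fun k => `|ext_seq v k| `^ p) m = \sum_i `|v i| `^ p.
Proof.
move=> nm; rewrite /series /= (big_cat_nat (n := n))//=.
rewrite [X in _ + X]big1_seq ?addr0; last first.
  move=> k; rewrite mem_index_iota => /andP[_ /andP[nk _]].
  rewrite /ext_seq insubF/= ?normr0 ?powR0//; last by rewrite ltnNge nk.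
  by rewrite gt_eqF// (lt_trans ltr01).
by rewrite big_mkord; apply: eq_bigr => i _; rewrite /ext_seq valK.
Qed.

Lemma near_series_ext_seq n (v : 'I_n -> R) :
  \forall m \near \oo, series (fun k => `|ext_seq v k| `^ p) m = \sum_i `|v i| `^ p.
Proof. by exists n => // m /= nm; exact: series_ext_seq. Qed.

Lemma in_lp_ext_seq n (v : 'I_n -> R) : in_lp p (ext_seq v).
Proof. exact: is_cvg_near_cst (near_series_ext_seq v). Qed.

Lemma lp_norm_ext_seq n (v : 'I_n -> R) : lp_norm p (ext_seq v) = pnorm p v.
Proof.
rewrite /lp_norm /pnorm; congr (_ `^ _).
exact: (lim_near_cst (@Rhausdorff R) (near_series_ext_seq v)).
Qed.

Context {D : BanachLattice R -> Prop}.

(** The [s i] form a contraction of [E] into l^p. Followed by a coordinate [J g] it becomes a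
    contraction into a lattice of [D], and since [J g] preserves the lattice operations it carries
    the value of [t] to a value bounded by [r]. Isometry of the family [J] gives back the p-norm. *)
Lemma lp_in_closure_bound (E : normedModType R) (t : lterm (R := R) E) n
    (s : 'I_n -> E -> R) (r : R) :
  lp_in_closure p D ->
  (forall i, lin_form (s i)) ->
  (forall x, \sum_i `|s i x| `^ p <= `|x| `^ p) ->
  0 <= r ->
  (forall (Y : BanachLattice R) (T : E -> Y), D Y -> lin_contraction T ->
     `|lterm_eval T t| <= r) ->
  pnorm p (fun i => reval (s i) t) <= r.
Proof.
move=> [G [X [J [DX JL JM Jle Jge]]]] ls sc r0 H.
have ilp m (v : 'I_m -> R) : in_lp p (ext_seq v) by exact: in_lp_ext_seq.
rewrite -lp_norm_ext_seq; apply: Jge => // g.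
pose S x := ext_seq (fun i => s i x).
(* Linearity of [J g] is given only in the form [a x + y]; the image of 0 is needed for pure
   multiples. *)
have J0 : J g (ext_seq (fun _ : 'I_n => 0)) = 0.
  pose o := ext_seq (fun _ : 'I_n => 0 : R).
  have := JL g 1 o o (ilp _ _) (ilp _ _).
  rewrite (_ : (fun k => _) = o); last first.
    by apply/funext => k; rewrite /o /ext_seq; case: insub => /=; rewrite ?addr0 ?mulr0 ?addr0.
  by rewrite scale1r => /eqP; rewrite -subr_eq0 opprD addrA subrr sub0r oppr_eq0 => /eqP.
have lT : lin_map (J g \o S).
  move=> a x y; rewrite /= -JL; try exact: ilp.
  congr (J g); apply/funext => k; rewrite /S /ext_seq; case: insub => [i|] /=.
    exact: ls.
  by rewrite mulr0 addr0.
have cT : lin_contraction (J g \o S).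
  split=> // x /=; apply: le_trans (Jle g _ _) _; first exact: ilp.
  rewrite lp_norm_ext_seq; apply: (ler_powRpP p1) => //; first exact: pnorm_ge0.
  by rewrite powR_pnorm.
suff -> : J g (ext_seq (fun i => reval (s i) t)) = lterm_eval (J g \o S) t by exact: H.
elim: t {H} => //= [t1 <- t2 <-|a t1 <-|t1 <- t2 <-].
- rewrite -[X in _ = X + _]scale1r -JL; try exact: ilp.
  congr (J g); apply/funext => k; rewrite /ext_seq; case: insub => [i|] /=;
    by rewrite mul1r// addr0.
- rewrite -[RHS]addr0 -J0 -JL; try exact: ilp.
  congr (J g); apply/funext => k; rewrite /ext_seq; case: insub => [i|] /=;
    by rewrite ?mulr0 addr0.
- rewrite -JM; try exact: ilp.
  congr (J g); apply/funext => k; rewrite /ext_seq; case: insub => [i|] //=.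
  by rewrite maxxx.
Qed.

Lemma rho_ge (C : BanachLattice R -> Prop) (E : normedModType R)
    (t : lterm (R := R) E) (Y : BanachLattice R) (T : E -> Y) :
  C Y -> lin_contraction T -> (`|lterm_eval T t|%:E <= rho C t)%E.
Proof. by move=> CY cT; apply: ereal_sup_ubound; exists Y, T. Qed.

Lemma rho_ge0 (C : BanachLattice R -> Prop) (E : normedModType R)
    (t : lterm (R := R) E) : (exists Y, C Y) -> (0 <= rho C t)%E.
Proof.
move=> [Y CY]; apply: le_trans (rho_ge t CY (T := fun=> 0) _).
  by rewrite lee_fin.
by split=> [a x y|x]; rewrite ?scaler0 ?addr0// normr0.
Qed.

Lemma rho_le (C : BanachLattice R -> Prop) (E : normedModType R)
    (t : lterm (R := R) E) (r : R) :
  (forall (Y : BanachLattice R) (T : E -> Y), C Y -> lin_contraction T ->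
     `|lterm_eval T t| <= r) -> (rho C t <= r%:E)%E.
Proof.
move=> H; apply: ge_ereal_sup => _ [Y [T [CY cT ->]]].
by rewrite lee_fin; exact: H.
Qed.

Lemma rho_Cp_le (E : normedModType R) (t : lterm (R := R) E) :
  (exists Y, D Y) -> lp_in_closure p D -> (rho (Cp p) t <= rho D t)%E.
Proof.
move=> D0 lpD; have := rho_ge0 t D0.
(* An infinite value on the right is harmless, and [-oo] is excluded because [D] is non-empty. *)
case rE : (rho D t) => [r| |]; [|by move=> _; exact: leey|by rewrite leNgt ltNy0].
rewrite lee_fin => r0; apply: rho_le => Y T CY cT.
have [I [s [Q [ls sc sQ tQ]]]] := lp_norming p1 t.
have sumE (F : I -> R) : \sum_i F i = \sum_(i < #|I|) F (enum_val i).
  by rewrite -big_enum_val.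
have := @lp_in_closure_bound E t #|I| (fun i => s (enum_val i)) r lpD.
move=> /(_ (fun i => ls _) _ r0)Hr.
apply: le_trans (_ : pnorm p (fun i : 'I_#|I| => reval (s (enum_val i)) t) <= _).
  apply: (ler_powRpP p1) => //; first exact: pnorm_ge0.
  by rewrite powR_pnorm// -(sumE (fun i => `|reval (s i) t| `^ p)) sQ tQ.
apply: Hr => [x|Z S DZ cS]; first by rewrite -(sumE (fun i => `|s i x| `^ p)).
by rewrite -lee_fin -rE; exact: rho_ge.
Qed.

Lemma rho_le_Cp (E : normedModType R) (t : lterm (R := R) E) :
  (forall Y, D Y -> Cp p Y) -> (rho D t <= rho (Cp p) t)%E.
Proof.
move=> DC; apply: ereal_sup_le => r [Y [T [DY cT ->]]].
by exists Y, T; split=> //; exact: DC.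
Qed.

(** Take [E = Y]. A finite join approximating the p-sum is the value of a term at the identity, so
    its norm is at most [rho D t <= rho (Cp p) t]. Under a contraction into a lattice of [Cp p] the
    term stays below the p-sum of the images, which p-convexity bounds. *)
Lemma Cp_of_rho (Y : BanachLattice R) :
  (forall t : lterm (R := R) Y, (rho D t <= rho (Cp p) t)%E) -> D Y -> Cp p Y.
Proof.
move=> H DY n x z [zub zlub]; set B := (X in _ <= X).
pose e := \sum_i bl_abs (x i).
have zB (m : nat) : `|z| <= B + m.+1%:R^-1 * `|e|.
  have [L] := psum_net p1 x m.
  set zm := ne_fold _ _ => -[Lb Lub Llub].
  have zmz : bl_le zm z by apply: Llub => a ha; apply: zub; exists a.
  have zzm : bl_le z (zm + m.+1%:R^-1 *: e).
    by apply: zlub => _ [a ha <-]; exact: Lub.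
  have zmB : `|zm| <= B.
    pose t := ne_fold (@LJoin R Y) (ne_map (fun a => LVar (lincomb x a)) L).
    have tE (Z : BanachLattice R) (T : Y -> Z) :
        lterm_eval T t = ne_fold (@bl_join R Z) (ne_map (T \o lincomb x) L).
      by rewrite -(@ne_fold_morph _ _ (lterm_eval T) (@LJoin R Y) (@bl_join R Z)) ?ne_map_comp.
    have -> : zm = lterm_eval id t by rewrite tE.
    rewrite -lee_fin; apply: le_trans (_ : rho D t <= _)%E.
      by apply: rho_ge => //; split.
    apply: le_trans (H t) _; apply: rho_le => Z T CZ [lT Tc].
    have [w [wub wlub]] := psum_exists p1 (T \o x).
    have Tle a : dual_ball p a -> bl_le (T (lincomb x a)) w.
      move=> ha; apply: wub; exists a => //.
      rewrite (lin_map_sum lT); apply: eq_bigr => i _.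
      by rewrite (lin_mapZ lT).
    have tw : bl_le (lterm_eval T t) w.
      by rewrite tE; apply: ne_fold_join_lub => a /Lb; exact: Tle.
    (* The lower bound uses the symmetry of the dual ball: [- T (lincomb x a)] is the image of the
       combination with coefficients [- a]. *)
    have Ntw : bl_le (- lterm_eval T t) w.
      have [a aL] : exists a, ne_in a L.
        by case: (L) => [a|a k]; exists a => //=; left.
      apply: (@bl_le_trans _ _ (- T (lincomb x a))).
        by apply: bl_leN; rewrite tE; exact: (@ne_fold_join_ub _ _ _ (T \o lincomb x)).
      rewrite -(lin_mapN lT) (_ : - lincomb x a = lincomb x (fun i => - a i)).
        apply: Tle; apply: dual_ball_sub (Lb _ aL) => // i.
        by rewrite normrN.
      by rewrite /lincomb -sumrN; apply: eq_bigr => i _; rewrite scaleNr.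
    apply: (le_trans (bl_norm_le tw Ntw)).
    apply: (le_trans (CZ _ _ _ (conj wub wlub))).
    apply: (ler_powRVp p1).
      by apply: sumr_ge0 => i _; exact: powR_ge0.
    by apply: ler_sum => i _; apply: (ler_powRp p1) => //; exact: Tc.
  have dz : `|z - zm| <= m.+1%:R^-1 * `|e|.
    rewrite -[X in X * _]ger0_norm ?invr_ge0// -normrZ; apply: bl_norm_le.
      by have := bl_leD2r (- zm) zzm; rewrite addrAC subrr add0r.
    apply: (@bl_le_trans _ _ 0).
      by apply: bl_oppr_le0; apply/bl_subr_ge0.
    by apply: bl_scale_ge0; [rewrite invr_ge0|exact: bl_sum_abs_ge0].
  rewrite -(subrK zm z) addrC; apply: le_trans (ler_normD _ _) _.
  exact: lerD.
apply/ler_addgt0Pr => d d0; apply: le_trans (zB (Num.truncn (`|e| / d))) _.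
rewrite lerD2l mulrC ler_pdivrMr// mulrC -ler_pdivrMr//.
by have /andP[_ /ltW] := truncn_itv (divr_ge0 (normr_ge0 e) (ltW d0)).
Qed.

End FiniteSequences.

(** * The Banach lattice l^p_n *)

(** A separate name for row vectors, to carry the p-norm in place of their sup norm; the proof [p1]
    is a parameter because the norm axioms depend on it. *)
Definition lpn (R : realType) (p : R) (p1 : 1 < p) (n : nat) : Type := 'rV[R]_n.

Section Lpn.
Context {R : realType} (p : R) (p1 : 1 < p) (n : nat).
Local Notation L := (lpn p1 n).

HB.instance Definition _ := GRing.Lmodule.copy L 'rV[R]_n.

Definition lpn_norm (x : L) : R := pnorm p (fun i => (x : 'rV[R]_n) 0 i).

Fact lpn_normD (x y : L) : lpn_norm (x + y) <= lpn_norm x + lpn_norm y.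
Proof.
apply: le_trans (pnormD p1 _ _); rewrite le_eqVlt; apply/orP; left.
by apply/eqP; congr pnorm; apply/funext => i; rewrite mxE.
Qed.

Fact lpn_normZ (a : R) (x : L) : lpn_norm (a *: x) = `|a| * lpn_norm x.
Proof.
by rewrite -(pnormZ p1); congr pnorm; apply/funext => i; rewrite mxE.
Qed.

Fact lpn_norm0_eq0 (x : L) : lpn_norm x = 0 -> x = 0.
Proof. by move=> /(pnorm_eq0 p1) x0; apply/rowP => i; rewrite mxE. Qed.

HB.instance Definition _ :=
  Lmodule_isNormed.Build R L lpn_normD lpn_normZ lpn_norm0_eq0.

Lemma lpn_normE (x : L) : `|x| = pnorm p (fun i => (x : 'rV[R]_n) 0 i).
Proof. by []. Qed.

(** The p-norm is at most [n^(1/p)] times the largest coordinate; the added 1 makes the inequality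
    strict and covers [n = 0]. *)
Lemma lpn_norm_lt (x : L) (d : R) : 0 < d ->
  (forall i, `|(x : 'rV[R]_n) 0 i| <= d / (n%:R `^ p^-1 + 1)) -> `|x| < d.
Proof.
move=> d0 xd; set c := n%:R `^ p^-1.
have c1 : 0 < c + 1 by rewrite ltr_wpDl ?powR_ge0.
have dc0 : 0 <= d / (c + 1) by rewrite divr_ge0// ltW.
apply: le_lt_trans (_ : c * (d / (c + 1)) < d).
  rewrite lpn_normE /pnorm -(powRpK p1 dc0) -powRM ?powR_ge0//.
  apply: (ler_powRVp p1); first exact: sum_powR_ge0.
  rewrite -[X in X%:R]card_ord -sum1_card natr_sum mulr_suml.
  apply: ler_sum => i _; rewrite mul1r.
  by apply: (ler_powRp p1).
by rewrite mulrA ltr_pdivrMr// mulrC ltr_pM2l// ltrDl.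
Qed.

Fact lpn_complete (F : set_system L) : ProperFilter F -> cauchy F -> cvg F.
Proof.
move=> FF /cauchyP Fc.
have coord i : cvg ((fun x : L => (x : 'rV[R]_n) 0 i) @ F).
  apply: R_complete; apply/cauchyP => e e0; have [x Fx] := Fc e e0.
  exists ((x : 'rV[R]_n) 0 i); apply: (@filterS _ F _ _ _ _ Fx) => y.
  rewrite -!ball_normE /ball_ /=; apply: le_lt_trans.
  have -> : (x : 'rV[R]_n) 0 i - (y : 'rV[R]_n) 0 i = (x - y : 'rV[R]_n) 0 i.
    by rewrite !mxE.
  exact: (pnorm_coord p1).
pose l : L := \row_i lim ((fun x : L => (x : 'rV[R]_n) 0 i) @ F).
apply/cvg_ex; exists l; apply/fcvgrPdist_lt => d d0.
have c1 : 0 < n%:R `^ p^-1 + 1 :> R by rewrite ltr_wpDl ?powR_ge0.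
have : \forall x \near F, forall i, `|(l : 'rV[R]_n) 0 i - (x : 'rV[R]_n) 0 i| <=
    d / (n%:R `^ p^-1 + 1).
  apply: filter_forall => i.
  have /cvgrPdist_le/(_ _ (divr_gt0 d0 c1)) := coord i.
  by rewrite mxE.
apply: filterS => x h; apply: lpn_norm_lt => // i.
by have := h i; rewrite !mxE.
Qed.

HB.instance Definition _ := Uniform_isComplete.Build L lpn_complete.

Definition lpn_join (x y : L) : L :=
  \row_i Num.max ((x : 'rV[R]_n) 0 i) ((y : 'rV[R]_n) 0 i).

Fact lpn_joinC (x y : L) : lpn_join x y = lpn_join y x.
Proof. by apply/rowP => i; rewrite !mxE maxC. Qed.

Fact lpn_joinA (x y z : L) : lpn_join x (lpn_join y z) = lpn_join (lpn_join x y) z.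
Proof. by apply/rowP => i; rewrite !mxE maxA. Qed.

Fact lpn_joinxx (x : L) : lpn_join x x = x.
Proof. by apply/rowP => i; rewrite !mxE maxxx. Qed.

Fact lpn_joinD (x y z : L) : lpn_join (x + z) (y + z) = lpn_join x y + z.
Proof. by apply/rowP => i; rewrite !mxE addr_maxl. Qed.

Fact lpn_joinZ (a : R) (x y : L) : 0 <= a ->
  lpn_join (a *: x) (a *: y) = a *: lpn_join x y.
Proof. by move=> a0; apply/rowP => i; rewrite !mxE maxr_pMr. Qed.

Fact lpn_normM (x y : L) :
  lpn_join (lpn_join x (- x)) (lpn_join y (- y)) = lpn_join y (- y) -> `|x| <= `|y|.
Proof.
move=> /rowP xy; apply: (ler_pnorm p1) => i.
by have := xy i; rewrite !mxE !maxrN => <-; rewrite le_max lexx.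
Qed.

Definition lpn_BL : BanachLattice R :=
  @BanachLatticeMk R L lpn_join lpn_joinC lpn_joinA lpn_joinxx lpn_joinD
    lpn_joinZ lpn_normM.

Lemma lpn_leP (x y : lpn_BL) :
  bl_le x y <-> forall i, (x : 'rV[R]_n) 0 i <= (y : 'rV[R]_n) 0 i.
Proof.
split=> [/rowP xy i|xy]; first by have := xy i; rewrite !mxE => <-; rewrite le_max lexx.
by apply/rowP => i; rewrite mxE max_r.
Qed.

(** The p-sum is dominated by the vector [y] of coordinatewise p-norms, and the norm of [y] is
    computed by exchanging the two sums. *)
Lemma lpn_Cp : Cp p lpn_BL.
Proof.
move=> m x z [zub zlub].
pose y : lpn_BL := \row_k pnorm p (fun i => (x i : 'rV[R]_n) 0 k).
have zy : bl_le z y.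
  apply: zlub => _ [a ha <-]; apply/lpn_leP => k.
  rewrite mxE summxE; apply: le_trans (ler_sum_pnorm p1 _ ha).
  by rewrite le_eqVlt; apply/orP; left; apply/eqP/eq_bigr => i _; rewrite mxE.
have z0 : bl_le 0 z.
  apply: zub; exists (fun=> 0); first exact: dual_ball0.
  by rewrite big1// => i _; rewrite scale0r.
apply: le_trans (_ : `|y| <= _).
  apply: bl_norm_le => //; apply: bl_le_trans (bl_le_trans z0 zy).
  exact: bl_oppr_le0.
rewrite [leLHS]lpn_normE /pnorm; apply: (ler_powRVp p1); first exact: sum_powR_ge0.
rewrite (eq_bigr (fun k => \sum_i `|(x i : 'rV[R]_n) 0 k| `^ p)); last first.
  by move=> k _; rewrite mxE ger0_norm ?pnorm_ge0// powR_pnorm.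
rewrite exchange_big; apply: ler_sum => i _.
by rewrite [in leRHS]lpn_normE powR_pnorm.
Qed.

Lemma lpn_coord_eval (t : lterm (R := R) lpn_BL) i :
  (lterm_eval id t : 'rV[R]_n) 0 i = reval (fun x : lpn_BL => (x : 'rV[R]_n) 0 i) t.
Proof. by elim: t => //= [s <- u <-|a s <-|s <- u <-]; rewrite mxE. Qed.

End Lpn.

(** * Disjointification and the embedding of l^p *)

Section Disjointification.
Context {R : realType}.

Definition excess n (u : 'I_n -> R) (k : 'I_n) : R :=
  Num.max (`|u k| - \sum_(j | j != k) `|u j|) 0.

Lemma excess_ge0 n (u : 'I_n -> R) k : 0 <= excess u k.
Proof. by rewrite le_max lexx orbT. Qed.

Lemma excess_le n (u : 'I_n -> R) k : excess u k <= `|u k|.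
Proof.
by rewrite ge_max normr_ge0 andbT gerBl; apply: sumr_ge0.
Qed.

Lemma excess_neq0 n (u : 'I_n -> R) k j : j != k -> excess u k != 0 -> `|u j| < `|u k|.
Proof.
move=> jk h; apply: le_lt_trans (_ : \sum_(i | i != k) `|u i| < _); last first.
  by rewrite ltNge; apply: contra h => uk; rewrite /excess max_r// subr_le0.
by rewrite (bigD1 j)//= lerDl; apply: sumr_ge0.
Qed.

(** A non-zero excess at [k] makes [|u k|] strictly larger than every other [|u j|], which cannot
    happen at two indices. *)
Lemma excess_disjoint n (u : 'I_n -> R) :
  (forall k, excess u k = 0) \/ exists k0, forall k, k != k0 -> excess u k = 0.
Proof.
have [[k0 h0]|h] := pselect (exists k, excess u k != 0); last first.
  by left => k; apply/eqP; apply: contrapT => /negP hk; apply: h; exists k.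
right; exists k0 => k kk0; apply/eqP; apply: contrapT => /negP hk.
have kk0' : k0 != k by rewrite eq_sym.
by have := lt_trans (excess_neq0 kk0 h0) (excess_neq0 kk0' hk); rewrite ltxx.
Qed.

(** The index [k0] does not depend on [c], so identities between several such combinations reduce to
    one coordinate. *)
Lemma sum_excess n (u : 'I_n -> R) :
  (forall c : 'I_n -> R, \sum_k c k * excess u k = 0) \/
  exists k0, forall c : 'I_n -> R, \sum_k c k * excess u k = c k0 * excess u k0.
Proof.
have [h|[k0 h]] := excess_disjoint u; [left|right; exists k0] => c.
  by rewrite big1// => k _; rewrite h mulr0.
by rewrite (bigD1 k0)//= big1 ?addr0// => k /h ->; rewrite mulr0.
Qed.

Context {E : lmodType R}.

Definition tabs (x : E) : lterm (R := R) E := LJoin (LVar x) (LScale (-1) (LVar x)).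

Definition texcess n (e : 'I_n -> E) (k : 'I_n) : lterm (R := R) E :=
  LJoin (LAdd (tabs (e k))
    (LScale (-1) (\big[@LAdd R E/LVar 0]_(j | j != k) tabs (e j)))) (LVar 0).

Definition tcomb n (e : 'I_n -> E) (c : 'I_n -> R) : lterm (R := R) E :=
  \big[@LAdd R E/LVar 0]_k LScale (c k) (texcess e k).

Lemma reval_texcess n (e : 'I_n -> E) k (f : E -> R) : lin_form f ->
  reval f (texcess e k) = excess (f \o e) k.
Proof.
move=> lf; rewrite /texcess /excess /= (lin_form0 lf) mulN1r maxrN.
rewrite (big_morph (reval f) (id1 := 0) (op1 := +%R))//; last exact: lin_form0.
by rewrite mulN1r; congr (Num.max (_ - _) _); apply: eq_bigr => j _; rewrite /= mulN1r maxrN.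
Qed.

Lemma reval_tcomb n (e : 'I_n -> E) c (f : E -> R) : lin_form f ->
  reval f (tcomb e c) = \sum_k c k * excess (f \o e) k.
Proof.
move=> lf; rewrite (big_morph (reval f) (id1 := 0) (op1 := +%R))//; last exact: lin_form0.
by apply: eq_bigr => k _; rewrite -reval_texcess.
Qed.

Context {X : BanachLattice R} (T : E -> X).
Hypothesis lT : lin_map T.

Lemma eval_tabs x : lterm_eval T (tabs x) = bl_abs (T x).
Proof. by rewrite /= scaleN1r. Qed.

Lemma eval_tcomb n (e : 'I_n -> E) c :
  lterm_eval T (tcomb e c) = \sum_k c k *: lterm_eval T (texcess e k).
Proof.
by rewrite (big_morph (lterm_eval T) (id1 := 0) (op1 := +%R))//=; exact: lin_map0.
Qed.

(** By transfer it suffices to evaluate at a linear form, where at most one summand survives and its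
    excess is non-negative. This is why the embedding preserves joins. *)
Lemma eval_tcomb_max n (e : 'I_n -> E) c d :
  lterm_eval T (tcomb e (fun k => Num.max (c k) (d k))) =
  bl_join (lterm_eval T (tcomb e c)) (lterm_eval T (tcomb e d)).
Proof.
rewrite -[RHS]/(lterm_eval T (LJoin (tcomb e c) (tcomb e d))).
apply: lterm_eq_transfer => // f lf; rewrite /= !reval_tcomb//.
have [h|[k0 h]] := sum_excess (f \o e); rewrite !h ?maxxx//.
by rewrite maxr_pMl// excess_ge0.
Qed.

Lemma eval_texcess_ge0 n (e : 'I_n -> E) k : bl_le 0 (lterm_eval T (texcess e k)).
Proof. by rewrite /= (lin_map0 lT); exact: bl_leUr. Qed.

Lemma norm_texcess n (e : 'I_n -> E) k : `|lterm_eval T (texcess e k)| <= `|T (e k)|.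
Proof.
have le : bl_le (lterm_eval T (texcess e k)) (bl_abs (T (e k))).
  rewrite -eval_tabs; apply: lterm_le_transfer => // f lf.
  by rewrite reval_texcess//= mulN1r maxrN excess_le.
rewrite -(bl_norm_abs (T (e k))); apply: bl_norm_le => //.
apply: bl_le_trans (bl_abs_ge0 _); apply: bl_oppr_le0.
exact: eval_texcess_ge0.
Qed.

(** A sum of disjoint elements lies below the join of its summands and 0; again this is checked on
    linear forms. *)
Lemma tcomb_le_join n (e : 'I_n -> E) c w : bl_le 0 w ->
  (forall k, bl_le (c k *: lterm_eval T (texcess e k)) w) ->
  bl_le (lterm_eval T (tcomb e c)) w.
Proof.
move=> w0 cw.
pose t := \big[@LJoin R E/LVar 0]_k LScale (c k) (texcess e k).
apply: (@bl_le_trans _ _ (lterm_eval T t)).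
  apply: lterm_le_transfer => // f lf; rewrite reval_tcomb//.
  have -> : reval f t = \big[Num.max/0]_k (c k * excess (f \o e) k).
    rewrite (big_morph (reval f) (id1 := 0) (op1 := Num.max))//; last exact: lin_form0.
    by apply: eq_bigr => k _; rewrite -reval_texcess.
  have [->|[k0 ->]] := sum_excess (f \o e); first exact: bigmax_ge_id.
  exact: le_bigmax.
rewrite (big_morph (lterm_eval T) (id1 := 0) (op1 := @bl_join R X))//=; last exact: lin_map0.
by elim/big_ind: _ => // x y; exact: bl_leUx.
Qed.

(** For the disjoint elements [f k], the sum of the [|c k| f k] is also the p-sum of the [c k f k],
    so p-convexity applies to it. *)
Lemma eval_tcomb_le (p : R) n (e : 'I_n -> E) c : 1 < p -> Cp p X ->
  (forall k, `|T (e k)| <= 1) -> `|lterm_eval T (tcomb e c)| <= pnorm p c.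
Proof.
move=> p1 CX Te; pose f k := lterm_eval T (texcess e k).
have f0 k : bl_le 0 (f k) by exact: eval_texcess_ge0.
pose z := lterm_eval T (tcomb e (fun k => `|c k|)).
have zE : z = \sum_k `|c k| *: f k by exact: eval_tcomb.
have cz : bl_le (lterm_eval T (tcomb e c)) z.
  rewrite zE eval_tcomb; apply: bl_sum_le => k.
  by apply: (bl_scale2r (f0 k)); exact: ler_norm.
have Ncz : bl_le (- lterm_eval T (tcomb e c)) z.
  rewrite zE eval_tcomb -sumrN; apply: bl_sum_le => k; rewrite -scaleNr.
  by apply: (bl_scale2r (f0 k)); rewrite -normrN ler_norm.
apply: (le_trans (bl_norm_le cz Ncz)).
apply: le_trans (CX n (fun k => c k *: f k) z _) _; last first.
  apply: (ler_powRVp p1); first by apply: sumr_ge0 => k _; exact: powR_ge0.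
  apply: ler_sum => k _; apply: (ler_powRp p1) => //.
  rewrite normrZ -[leRHS]mulr1 ler_wpM2l//.
  exact: le_trans (norm_texcess e k) (Te k).
split=> [_ [a ha <-]|w wub].
  rewrite zE; apply: bl_sum_le => k; rewrite scalerA; apply: (bl_scale2r (f0 k)).
  apply: le_trans (ler_norm _) _; rewrite normrM -[leRHS]mul1r ler_wpM2r//.
  exact: (dual_ball_le1 p1).
have db (b : R) k : `|b| <= 1 -> dual_ball p (fun j => b * (j == k)%:R).
  move=> b1; rewrite /dual_ball /= (bigD1 k)//= big1 ?addr0 => [|j jk].
    rewrite eqxx mulr1 -[leRHS](_ : 1 `^ conj_exp p = 1); last by rewrite powR1.
    by apply: ge0_ler_powR; rewrite ?nnegrE// ltW// conj_exp_gt0.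
  by rewrite (negbTE jk) mulr0 normr0 powR0// gt_eqF// conj_exp_gt0.
have w0 : bl_le 0 w.
  apply: wub; exists (fun=> 0); first exact: dual_ball0.
  by rewrite big1// => i _; rewrite scale0r.
apply: tcomb_le_join => // k; apply: wub.
(* A signed unit vector of the dual ball singles out [|c k| f k]. *)
exists (fun j => Num.sg (c k) * (j == k)%:R).
  by apply: db; rewrite normr_sg; case: eqP.
rewrite (bigD1 k)//= big1 ?addr0 => [|j /negbTE ->].
  by rewrite eqxx mulr1 scalerA -normrEsg.
by rewrite mulr0 scale0r.
Qed.

End Disjointification.

(** * Isometric embedding of l^p into a product of lattices of [D] *)

Section Closure.
Context {R : realType} (p : R) (p1 : 1 < p) (D : BanachLattice R -> Prop).

(** The product runs over all contractions from all l^p_n into members of [D]; the coordinate at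
    such an index sees only the first n entries of a sequence. *)
Record contraction_index := ContractionIndex {
  ci_dim : nat;
  ci_lattice : BanachLattice R;
  ci_map : lpn_BL p1 ci_dim -> ci_lattice;
  ci_class : D ci_lattice;
  ci_contraction : lin_contraction ci_map
}.

Definition lpn_basis n (k : 'I_n) : lpn_BL p1 n := delta_mx 0 k.

Lemma norm_lpn_basis n (k : 'I_n) : `|lpn_basis k| = 1.
Proof.
rewrite lpn_normE /pnorm (bigD1 k)//= big1 ?addr0 => [|j jk].
  by rewrite mxE !eqxx normr1 powR1 powR1.
rewrite mxE (negbTE jk) andbF normr0 powR0// gt_eqF//.
exact: lt_trans p1.
Qed.

Lemma excess_delta n (i k : 'I_n) : excess (fun j => (i == j)%:R : R) k = (i == k)%:R.
Proof.
rewrite /excess; have [->|ik] := eqVneq i k.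
  rewrite big1 ?subr0 ?normr1 ?max_l// => j jk.
  by rewrite eq_sym (negbTE jk) normr0.
by rewrite normr0 sub0r max_r// oppr_le0; apply: sumr_ge0.
Qed.

(** At the identity of l^p_n the excess terms of the unit vectors give back the unit vectors. *)
Lemma norm_eval_basis n (c : 'I_n -> R) :
  `|lterm_eval id (tcomb (@lpn_basis n) c)| = pnorm p c.
Proof.
rewrite lpn_normE; congr pnorm; apply/funext => i.
rewrite lpn_coord_eval reval_tcomb; last by move=> a x y; rewrite !mxE.
rewrite (eq_bigr (fun k => c k * (i == k)%:R)); last first.
  move=> k _; rewrite -excess_delta; congr (_ * excess _ _).
  by apply/funext => j; rewrite /= mxE eqxx.
rewrite (bigD1 i)//= eqxx mulr1 big1 ?addr0// => k ki.
by rewrite eq_sym (negbTE ki) mulr0.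
Qed.

(** Membership of [D] in [Cp p] makes each coordinate contractive. Conversely, the p-norm of the
    first n entries is the norm of a term at the identity of l^p_n, hence at most
    [rho (Cp p) t = rho D t], a supremum over indices of the product. *)
Lemma lp_in_closure_of_rho :
  (forall (E : completeNormedModType R) (t : lterm (R := R) E),
     rho (Cp p) t = rho D t) ->
  (forall Y, D Y -> Cp p Y) -> lp_in_closure p D.
Proof.
move=> rhoE DC.
pose J (g : contraction_index) (x : R ^nat) : ci_lattice g :=
  lterm_eval (ci_map (c := g)) (tcomb (@lpn_basis (ci_dim g)) (fun k => x k)).
have series_le (x : R ^nat) n : in_lp p x -> \sum_(k < n) `|x k| `^ p <=
    limn (series (fun k => `|x k| `^ p)).
  move=> xp; rewrite -(big_mkord xpredT (fun k => `|x k| `^ p)).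
  apply: nondecreasing_cvgn_le => //; apply: nondecreasing_series => k _ _.
  exact: powR_ge0.
have lim_ge0 (x : R ^nat) : in_lp p x -> 0 <= limn (series (fun k => `|x k| `^ p)).
  by move=> xp; apply: le_trans (series_le x 0 xp); rewrite big_ord0.
exists contraction_index, ci_lattice, J; split.
- exact: ci_class.
- move=> g a x y _ _; rewrite /J !eval_tcomb; try exact: (ci_contraction g).1.
  rewrite scaler_sumr -big_split; apply: eq_bigr => k _ /=.
  by rewrite scalerDl scalerA.
- move=> g x y _ _; rewrite /J -eval_tcomb_max//; exact: (ci_contraction g).1.
- move=> g x xp; apply: le_trans (eval_tcomb_le (p := p) _ _ p1 _ _) _.
  + exact: (ci_contraction g).1.
  + exact: DC (ci_class g).
  + move=> k; apply: le_trans ((ci_contraction g).2 _) _.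
    by rewrite norm_lpn_basis.
  + rewrite /lp_norm; apply: (ler_powRVp p1); first exact: sum_powR_ge0.
    exact: series_le.
- move=> x r xp r0 Jr; apply: (ler_powRpP p1) => //; first exact: powR_ge0.
  rewrite powRVpK ?lim_ge0//; apply: limr_le => //.
  apply: nearW => n; rewrite /series /= big_mkord.
  rewrite -(powR_pnorm p1); apply: (ler_powRp p1); first exact: pnorm_ge0.
  rewrite -norm_eval_basis; set t := tcomb _ _.
  have : (`|lterm_eval id t|%:E <= rho (Cp p) t)%E.
    by apply: rho_ge; [exact: lpn_Cp|split].
  rewrite -lee_fin => /le_trans; apply; rewrite rhoE; apply: rho_le => Y T DY cT.
  exact: (Jr (ContractionIndex DY cT)).
Qed.

End Closure.

Theorem theorem3p6 (R : realType) (p : R) (D : BanachLattice R -> Prop) :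
  1 < p -> (exists Y : BanachLattice R, D Y) ->
  ((forall (E : completeNormedModType R) (t : lterm E),
      rho (Cp p) t = rho D t)
   <->
   ((forall Y : BanachLattice R, D Y -> Cp p Y) /\ lp_in_closure p D)).
Proof.
move=> p1 D0; split=> [rhoE|[DC lpD] E t].
  have DC Y : D Y -> Cp p Y by apply: Cp_of_rho => // t; rewrite rhoE.
  by split=> //; exact: (lp_in_closure_of_rho p1).
by apply/eqP; rewrite eq_le rho_Cp_le// rho_le_Cp.
Qed.
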